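(* For $n\geq1$, $k\geq2$ and $r\geq1$, the abelianization $(nV_{k,r})_{\mathrm{ab}}$ of the higher dimensional Thompson group $nV_{k,r}$ is as follows. (1) When $n=1$: $(1V_{k,r})_{\mathrm{ab}}\cong0$ if $k\in2\mathbb{Z}$, and $(1V_{k,r})_{\mathrm{ab}}\cong\mathbb{Z}_2$ if $k\in2\mathbb{Z}+1$. (2) When $n=2$: $(2V_{k,r})_{\mathrm{ab}}\cong\mathbb{Z}_{k-1}$ if $k\in2\mathbb{Z}$; $\mathbb{Z}_{k-1}\oplus\mathbb{Z}_2$ if $k\in4\mathbb{Z}+1$; $\mathbb{Z}_{2k-2}$ if $k\in4\mathbb{Z}+3$. (3) When $n\geq3$: $(nV_{k,r})_{\mathrm{ab}}\cong(\mathbb{Z}_{k-1})^{n-1}$ if $k\in2\mathbb{Z}$ or $k\in4\mathbb{Z}+3$; $(\mathbb{Z}_{k-1})^{n-1}\oplus\mathbb{Z}_2$ if $k\in4\mathbb{Z}+1$.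
   Context: $\mathbb{Z}_m$ is the cyclic group of order $m$ ($\mathbb{Z}_1=0$). Higher dimensional Thompson group $nV_{k,r}$: let $X=\{0,1,\dots,k-1\}^{\mathbb{N}}$ with the product topology. A brick in $\{1,\dots,r\}\times X^n$ is a set $\{j\}\times w_1X\times\dots\times w_nX$, where $j\in\{1,\dots,r\}$ and $w_d$ are finite (possibly empty) words over $\{0,\dots,k-1\}$, $w_dX$ being the set of sequences with prefix $w_d$. For two bricks, the canonical map $\{j\}\times w_1X\times\dots\times w_nX\to\{j'\}\times w'_1X\times\dots\times w'_nX$ is the prefix replacement $(j,w_1x_1,\dots,w_nx_n)\mapsto(j',w_1'x_1,\dots,w_n'x_n)$. Then $nV_{k,r}$ is the group of all homeomorphisms $h$ of $\{1,\dots,r\}\times X^n$ for which there are two finite partitions of $\{1,\dots,r\}\times X^n$ into the same number of bricks such that $h$ carries each brick of the first partition onto a brick of the second by the canonical map. ($1V_{k,r}=V_{k,r}$ is the Higman–Thompson group.) Equivalently, in the paper it is the topological full group of $\mathcal{G}_{A_{k,r}}\times\mathcal{G}_{A_{k,1}}^{\,n-1}$, where $\mathcal{G}_{A_{k,r}}$ is the groupoid of the one-sided shift of finite type with the $r\times r$ matrix $A_{k,r}$ having entry $k$ in position $(1,r)$, entries $1$ in positions $(i+1,i)$, and $0$ elsewhere. *)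

(* Defs.v *)
From HB Require Import structures.
From mathcomp Require Import all_boot all_order all_algebra.
From mathcomp Require Import generic_quotient.
From mathcomp Require Import all_classical all_reals topology.

Set Implicit Arguments.
Unset Strict Implicit.
Unset Printing Implicit Defensive.

Local Open Scope classical_set_scope.
Local Open Scope group_scope.
Local Open Scope quotient_scope.

Section Abelianization.
Variable G : groupType.

Inductive derived : G -> Prop :=
| derived1 : derived 1
| derivedR x y : derived (commg x y)
| derivedM x y : derived x -> derived y -> derived (x * y)
| derivedV x : derived x -> derived x^-1.

Definition ab_rel : rel G := fun x y => `[< derived (x^-1 * y) >].

Lemma derivedJ x y : derived x -> derived (conjg x y).
Proof.
by move=> dx; rewrite -(mulVKg x (conjg x y)); apply: derivedM (derivedR _ _).
Qed.

Lemma ab_rel_refl : reflexive ab_rel.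
Proof. by move=> x; apply/asboolP; rewrite mulVg; apply: derived1. Qed.

Lemma ab_rel_sym : symmetric ab_rel.
Proof.
by move=> x y; apply/asboolP/asboolP => /derivedV; rewrite invgM invgK.
Qed.

Lemma ab_rel_trans : transitive ab_rel.
Proof.
move=> y x z /asboolP xy /asboolP yz; apply/asboolP.
by have := derivedM xy yz; rewrite -mulgA mulVKg.
Qed.

Canonical ab_equiv := EquivRel ab_rel ab_rel_refl ab_rel_sym ab_rel_trans.

(* G / [G, G], with its (commutative) group law written additively *)
Definition abelianization := {eq_quot ab_rel}.
HB.instance Definition _ := Choice.on abelianization.
HB.instance Definition _ := EqQuotient.on abelianization.

Definition ab_zero : abelianization := lift_cst abelianization 1.
Definition ab_add := lift_op2 abelianization (fun x y => x * y).
Definition ab_opp := lift_op1 abelianization (fun x => x^-1).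

Canonical pi_ab_zero := PiConst ab_zero.

Lemma ab_piP (x y : G) :
  derived (x^-1 * y) -> \pi_abelianization x = \pi_abelianization y.
Proof. by move=> xy; apply/(@eqquotP _ ab_rel abelianization)/asboolP. Qed.

Lemma ab_piK (x : G) : derived (x^-1 * repr (\pi_abelianization x)).
Proof. by apply/asboolP/(@eqquotP _ ab_rel abelianization); rewrite reprK. Qed.

Lemma ab_add_morph :
  {morph \pi_abelianization : x y / x * y >-> ab_add x y}.
Proof.
move=> x y; unlock ab_add; apply: ab_piP.
have -> : (x * y)^-1 * (repr (\pi_abelianization x)
    * repr (\pi_abelianization y)) =
  conjg (x^-1 * repr (\pi_abelianization x)) y *
    (y^-1 * repr (\pi_abelianization y)).
  by rewrite /conjg invgM !mulgA mulgK.
by apply: derivedM (ab_piK y); apply: derivedJ (ab_piK x).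
Qed.
Canonical pi_ab_add := PiMorph2 ab_add_morph.

Lemma ab_opp_morph : {morph \pi_abelianization : x / x^-1 >-> ab_opp x}.
Proof.
move=> x; unlock ab_opp; apply: ab_piP; rewrite invgK.
set z := repr _; have -> : x * z^-1 = conjg (x^-1 * z)^-1 x^-1.
  by rewrite /conjg invgM !invgK -!mulgA mulgV mulg1.
by apply: derivedJ; apply: derivedV; apply: ab_piK.
Qed.
Canonical pi_ab_opp := PiMorph1 ab_opp_morph.

Lemma ab_addA : associative ab_add.
Proof. by move=> x y z; rewrite -[x]reprK -[y]reprK -[z]reprK !piE mulgA. Qed.

Lemma ab_addC : commutative ab_add.
Proof.
move=> x y; rewrite -[x]reprK -[y]reprK !piE; apply: ab_piP.
rewrite invgM -mulgA; exact: derivedR.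
Qed.

Lemma ab_add0 : left_id ab_zero ab_add.
Proof. by move=> x; rewrite -[x]reprK !piE mul1g. Qed.

Lemma ab_addN : left_inverse ab_zero ab_opp ab_add.
Proof. by move=> x; rewrite -[x]reprK !piE mulVg. Qed.

HB.instance Definition _ :=
  GRing.isZmodule.Build abelianization ab_addA ab_addC ab_add0 ab_addN.

End Abelianization.

Definition zmod_isomorphic (A B : zmodType) : Prop :=
  exists f : {additive A -> B}, bijective f.

(* Z_m for m >= 1; 'I_m.-1.+1 rather than 'Z_m, since 'Z_1 has two elements *)
Definition cyclicZ (m : nat) : zmodType := 'I_m.-1.+1.

Record homeo (T : topologicalType) := Homeo {
  homeo_fun :> T -> T;
  homeo_inv : T -> T;
  homeo_funK : cancel homeo_fun homeo_inv;
  homeo_invK : cancel homeo_inv homeo_fun;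
  homeo_cont : continuous homeo_fun;
  homeo_inv_cont : continuous homeo_inv
}.

HB.instance Definition _ T := gen_eqMixin (homeo T).
HB.instance Definition _ T := gen_choiceMixin (homeo T).

Section HomeoGroup.
Variable T : topologicalType.
Implicit Types f g h : homeo T.

Lemma homeo_ext f g : f =1 g -> f = g.
Proof.
case: f g => [f f' fK f'K cf cf'] [g g' gK g'K cg cg'] /= /funext fg.
have fg' : f' = g'.
  by apply/funext => x; rewrite -[in LHS](g'K x) -fg fK.
by subst; congr Homeo; exact: Prop_irrelevance.
Qed.

Definition homeo1 : homeo T :=
  @Homeo T id id (fun=> erefl) (fun=> erefl) (fun=> cvg_id) (fun=> cvg_id).

Definition homeoV f : homeo T :=
  Homeo (homeo_invK f) (homeo_funK f)
    (@homeo_inv_cont _ f) (@homeo_cont _ f).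

Lemma homeoM_cont (f g : T -> T) :
  continuous f -> continuous g -> continuous (f \o g).
Proof. by move=> cf cg x; apply: continuous_comp; [apply: cg|apply: cf]. Qed.

Definition homeoM f g : homeo T :=
  Homeo (can_comp (homeo_funK f) (homeo_funK g))
    (can_comp (homeo_invK g) (homeo_invK f))
    (homeoM_cont (@homeo_cont _ f) (@homeo_cont _ g))
    (homeoM_cont (@homeo_inv_cont _ g) (@homeo_inv_cont _ f)).

Lemma homeoMA : associative homeoM.
Proof. by move=> f g h; apply: homeo_ext. Qed.
Lemma homeo1M : left_id homeo1 homeoM.
Proof. by move=> f; apply: homeo_ext. Qed.
Lemma homeoM1 : right_id homeo1 homeoM.
Proof. by move=> f; apply: homeo_ext. Qed.
Lemma homeoVM : left_inverse homeo1 homeoV homeoM.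
Proof. by move=> f; apply: homeo_ext => x /=; rewrite homeo_funK. Qed.
Lemma homeoMV : right_inverse homeo1 homeoV homeoM.
Proof. by move=> f; apply: homeo_ext => x /=; rewrite homeo_invK. Qed.

HB.instance Definition _ :=
  isGroup.Build (homeo T) homeoMA homeo1M homeoM1 homeoVM homeoMV.

End HomeoGroup.

Definition words_space (k : nat) : topologicalType :=
  {ptws nat -> discrete_topology 'I_k}.

(* {1, ..., r} x X^n, with 'I_r = {0, ..., r-1} standing for {1, ..., r} *)
Definition thompson_space (n k r : nat) : topologicalType :=
  (discrete_topology 'I_r * {ptws 'I_n -> words_space k})%type.

(* the sequence w x; the default value of nth supplies the letters of x *)
Definition prepend k (w : seq 'I_k) (x : words_space k) : words_space k :=
  fun i => nth (x (i - size w)%N) w i.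

Section Bricks.
Variables n k r : nat.
Local Notation space := (thompson_space n k r).
Local Notation tails := ('I_n -> words_space k).

(* (j, w) encodes the brick {j} x w_1 X x ... x w_n X *)
Definition brick : Type := ('I_r * ('I_n -> seq 'I_k))%type.

Definition brick_point (b : brick) (x : tails) : space :=
  (b.1, fun d => prepend (b.2 d) (x d)).

Definition brick_set (b : brick) : set space := range (brick_point b).

(* h restricts to the canonical map (prefix replacement) from b onto b' *)
Definition carries (h : space -> space) (b b' : brick) : Prop :=
  forall x : tails, h (brick_point b x) = brick_point b' x.

Definition brick_partition (m : nat) (b : 'I_m -> brick) : Prop :=
  partition [set: 'I_m] (fun i => brick_set (b i)) [set: space].

Definition brick_exchange (h : space -> space) : Prop :=
  exists (m : nat) (b b' : 'I_m -> brick),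
    [/\ brick_partition b, brick_partition b' &
        forall i, exists j, carries h (b i) (b' j)].

Definition thompson_pred : {pred homeo space} :=
  fun h => `[< brick_exchange h >].

(* Closure under the group operations, through an equivalent condition using
   bricks all of whose words have one fixed length. *)

Definition extend (b : brick) (s : 'I_n -> seq 'I_k) : brick :=
  (b.1, fun d => b.2 d ++ s d).

Definition uprefix (N : nat) (p : space) : brick := (p.1, fun d => mkseq (p.2 d) N).

Definition uniformly_exchanges (h : space -> space) :=
  exists N, forall p, exists b', carries h (uprefix N p) b'.

Lemma prepend_cat (w s : seq 'I_k) (x : words_space k) :
  prepend (w ++ s) x = prepend w (prepend s x).
Proof.
apply/funext => i; rewrite /prepend nth_cat size_cat subnDA.
by case: ltnP => wi; [exact: set_nth_default | rewrite [RHS]nth_default].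
Qed.

Lemma prepend_mkseq (x : words_space k) N :
  prepend (mkseq x N) (fun i => x (N + i)%N) = x.
Proof.
apply/funext => i; rewrite /prepend size_mkseq.
case: (ltnP i N) => iN; first by rewrite nth_mkseq.
by rewrite nth_default ?size_mkseq // subnKC.
Qed.

Lemma mkseq_prepend (w : seq 'I_k) (x : words_space k) N : (size w <= N)%N ->
  mkseq (prepend w x) N = w ++ mkseq x (N - size w).
Proof.
move=> wN; apply: (@eq_from_nth _ (x 0%N)).
  by rewrite size_cat !size_mkseq subnKC.
move=> i; rewrite size_mkseq => iN; rewrite nth_mkseq // nth_cat /prepend.
case: ltnP => wi; first exact: set_nth_default.
by rewrite nth_default // nth_mkseq // ltn_sub2r // (leq_ltn_trans wi).
Qed.

Lemma mkseq_prepend_take (w : seq 'I_k) (x : words_space k) N :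
  (N <= size w)%N -> mkseq (prepend w x) N = take N w.
Proof.
move=> wN; apply: (@eq_from_nth _ (x 0%N)).
  by rewrite size_mkseq size_takel.
move=> i; rewrite size_mkseq => iN; rewrite nth_mkseq // nth_take //.
by apply: set_nth_default; apply: leq_trans wN.
Qed.

Lemma brick_point_extend b s x :
  brick_point (extend b s) x = brick_point b (fun d => prepend (s d) (x d)).
Proof.
by congr pair; apply/funext => d /=; rewrite prepend_cat.
Qed.

Lemma carries_extend h b b' s :
  carries h b b' -> carries h (extend b s) (extend b' s).
Proof. by move=> hb x; rewrite !brick_point_extend. Qed.

Lemma brick_point_prefix N p :
  brick_point (uprefix N p) (fun d i => p.2 d (N + i)%N) = p.
Proof.
case: p => j p; congr pair; apply/funext => d /=; exact: prepend_mkseq.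
Qed.

Lemma prefix_long N b x : (forall d, size (b.2 d) <= N)%N ->
  uprefix N (brick_point b x) =
  extend b (fun d => mkseq (x d) (N - size (b.2 d))).
Proof.
by move=> bN; congr pair; apply/funext => d; rewrite /= mkseq_prepend.
Qed.

Lemma prefix_short N b x : (forall d, N <= size (b.2 d))%N ->
  b = extend (uprefix N (brick_point b x)) (fun d => drop N (b.2 d)).
Proof.
case: b => j w /= wN; congr pair; apply/funext => d /=.
by rewrite mkseq_prepend_take // cat_take_drop.
Qed.

Lemma brick_exchange_uniform h : brick_exchange h -> uniformly_exchanges h.
Proof.
move=> [m [b [b' [[cb _ _] _ hb]]]].
exists (\max_(i < m) \max_(d < n) size ((b i).2 d)) => p.
have [i _ [x _ <-]] : cover [set: 'I_m] (fun i => brick_set (b i)) p.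
  by rewrite cb.
have [j hj] := hb i; rewrite prefix_long; last first.
  move=> d; apply: leq_trans (leq_bigmax i).
  exact: (leq_bigmax (F := fun d => size ((b i).2 d))).
by eexists; apply: carries_extend hj.
Qed.

Lemma uniform_brick_exchange (h : homeo space) :
  uniformly_exchanges h -> brick_exchange h.
Proof.
move=> [N hN].
pose I : finType := ('I_r * {ffun 'I_n -> N.-tuple 'I_k})%type.
pose br (u : I) : brick := (u.1, fun d => tval (u.2 d)).
pose code (p : space) : I :=
  (p.1, [ffun d => [tuple of mkseq (p.2 d) N]]).
have brE p : br (code p) = uprefix N p.
  by congr pair; apply/funext => d; rewrite /= ffunE.
have codeE u x : code (brick_point (br u) x) = u.
  case: u => j w; congr pair; apply/ffunP => d; rewrite ffunE.
  apply: val_inj => /=.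
  by rewrite mkseq_prepend_take ?size_tuple // take_oversize ?size_tuple.
pose A : {pred I} := fun u => `[< exists p, code p = u >].
have /choice[c hc] : forall i : 'I_#|A|,
    exists b', carries h (br (enum_val i)) b'.
  move=> i; have /asboolP[p <-] := enum_valP i; rewrite brE; exact: hN.
have cov p : exists i : 'I_#|A|, br (enum_val i) = uprefix N p.
  have Ap : code p \in A by apply/asboolP; exists p.
  by exists (enum_rank_in Ap (code p)); rewrite enum_rankK_in // brE.
have inh (i : 'I_#|A|) : exists x : tails, True.
  have /asboolP[p _] := enum_valP i.
  by exists (fun d i => p.2 d (N + i)%N).
have disj (i j : 'I_#|A|) x y : brick_point (br (enum_val i)) x =
    brick_point (br (enum_val j)) y -> i = j.
  by move=> /(congr1 code); rewrite !codeE => /enum_val_inj.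
exists #|A|, (fun i => br (enum_val i)), c; split; last by move=> i; exists i.
- split.
  + apply/seteqP; split=> // p _; have [i ip] := cov p.
    exists i => //; rewrite ip -[X in brick_set _ X](brick_point_prefix N p).
    by eexists.
  + by move=> i j _ _ [_ [[x _ <-] [y _ /esym]]]; apply: disj.
  + by move=> i _; have [x _] := inh i; eexists; exists x.
- split.
  + apply/seteqP; split=> // p _; have [i ip] := cov (homeo_inv h p).
    exists i => //; rewrite -[p](homeo_invK h).
    rewrite -(brick_point_prefix N (homeo_inv h p)) -ip hc; by eexists.
  + move=> i j _ _ [_ [[x _ <-] [y _ /esym]]].
    by rewrite -!hc => /(can_inj (homeo_funK h)); apply: disj.
  + by move=> i _; have [x _] := inh i; eexists; exists x.
Qed.

Lemma thompson_closed : group_closed thompson_pred.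
Proof.
split=> [|f g].
  apply/asboolP/uniform_brick_exchange; exists 0%N => p; exists (uprefix 0 p).
  by move=> x.
move=> /asboolP/brick_exchange_uniform[N fN] /asboolP gE.
apply/asboolP/uniform_brick_exchange.
have /brick_exchange_uniform[M gM] : brick_exchange (homeo_inv g).
  have [m [b [b' [pb [cb' tb' nb'] gb]]]] := gE.
  exists m, b', b; split=> // j; have [p [x _ xp]] := nb' j I.
  have [i _ [y _ yp]] :
      cover [set: 'I_m] (fun i => brick_set (b i)) (homeo_inv g p).
    by case: pb => ->.
  have [j' gj'] := gb i.
  have jj' : j = j'.
    apply: tb' => //; exists p; split; first by exists x.
    by exists y => //; rewrite -gj' yp homeo_invK.
  by exists i => z; rewrite jj' -gj' homeo_funK.
exists (M + N)%N => p; have [c gc] := gM p.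
pose s d := mkseq (fun i => p.2 d (M + i)%N) N.
have pE : uprefix (M + N) p = extend (uprefix M p) s.
  rewrite -{1}(brick_point_prefix M p) prefix_long => [|d].
    by congr pair; apply/funext => d /=; rewrite size_mkseq addKn.
  by rewrite size_mkseq leq_addr.
have gs := carries_extend s gc; rewrite -pE in gs.
pose x := fun d i => p.2 d (M + N + i)%N.
have cE := @prefix_short N (extend c s) x.
rewrite {}cE in gs => [|d]; last by rewrite size_cat size_mkseq leq_addl.
have [e fe] := fN (brick_point (extend c s) x).
eexists => z /=; rewrite gs; exact: carries_extend fe _.
Qed.

End Bricks.

(* nV_{k,r}; the product is composition of maps *)
Record thompson (n k r : nat) := Thompson {
  thompson_homeo :> homeo (thompson_space n k r);
  _ : thompson_homeo \in @thompson_pred n k r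
}.

HB.instance Definition _ n k r := [isSub for @thompson_homeo n k r].
HB.instance Definition _ n k r := [Choice of thompson n k r by <:].
HB.instance Definition _ n k r :=
  SubChoice_isSubGroup.Build _ _ (thompson n k r) (@thompson_closed n k r).

(* Main.v *)
(* Write T for nV_{k,r} and T_ab for its abelianization. An element of T is given
   by two tilings P and Q by equally many bricks, listed in an order such that the
   i-th brick of P goes to the i-th brick of Q; splitting the i-th bricks of both
   in the same direction does not change the element.

   Upper bound. All transpositions of two bricks in tilings by at least three
   bricks are conjugate; let s be their class in T_ab. Up to a multiple of s the
   class of P -> Q does not depend on the orders, and replacing P by its split in
   direction d at some brick does not depend on the brick chosen. As any two
   tilings have a common refinement by splittings (into bricks all of whose words
   have a fixed length), T_ab is generated by s and by the classes e_d of the baker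
   maps turning a split in direction 0 into a split in direction d. Here 2s = 0,
   s = 0 if k is even, e_0 = 0, and cutting a brick in two directions in both
   orders gives (k - 1)(e_d - e_{d'}) = C(k,2) s for distinct d and d'.

   Lower bound. For disjoint bricks b and c let omega(b, c) be the parity of the
   number of pairs of cells (x, y) of a fine uniform grid with x in b, y in c and
   x before y in the order interleaving the digits of all coordinates. For k odd,
   omega is additive under splitting and omega(b, c) + omega(c, b) = 1. For a group
   B, an element s of order at most 2 in B and a weight F on bricks, put
     Psi(P) = sum_i F(P_i) + (sum_{i < j} omega(P_i, P_j)) s.
   If F is chosen so that a split in direction d changes Psi by a constant gamma_d,
   then Psi(Q) - Psi(P) depends only on the element P -> Q and defines a morphism
   T_ab -> B sending s to s and e_d to gamma_d - gamma_0. When C(k,2) s = 0, linear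
   functions of the lengths of the words serve as F; when n = 2 and k = 3 mod 4 a
   quadratic correction with values in {0, s} is needed, and B is Z_{2k-2}. *)

Require Import Defs.
From HB Require Import structures.
From mathcomp Require Import all_boot all_algebra.
From mathcomp Require Import all_classical topology.
From mathcomp Require Import zify.

Set Implicit Arguments.
Unset Strict Implicit.
Unset Printing Implicit Defensive.

Import GRing.Theory.

(** * Tilings by bricks and their splits *)

Section Tilings.
Local Open Scope classical_set_scope.
Variables n k r : nat.
Local Notation space := (thompson_space n k r).
Local Notation tails := ('I_n -> words_space k).
Local Notation brick := (brick n k r).
Implicit Types (b c : brick) (p : space) (P Q U V W : seq brick).

(** A boolean test for membership in [brick_set], so that [count] can express how often a point is
    covered. *)
Definition inb p b :=
  (b.1 == p.1 :> 'I_r) &&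
  [forall d, mkseq (p.2 d) (size (b.2 d)) == b.2 d :> seq 'I_k].

Definition tail_in b p : tails := fun d i => p.2 d (size (b.2 d) + i).

Lemma inb_point b x : inb (brick_point b x) b.
Proof.
rewrite /inb eqxx /=; apply/forallP => d /=.
by rewrite mkseq_prepend // subnn cats0.
Qed.

Lemma brick_pointK b p : inb p b -> brick_point b (tail_in b p) = p.
Proof.
case: p => j p /andP[/eqP /= bj /forallP /= bp]; congr pair => //.
apply/funext => d /=; have /eqP bd := bp d.
by rewrite -[X in prepend X _]bd /tail_in prepend_mkseq.
Qed.

Definition ext b (d : 'I_n) (i : 'I_k) : brick :=
  extend b (fun e => if e == d then [:: i] else [::]).

Definition spl d b := [seq ext b d i | i <- enum 'I_k].

Lemma size_spl d b : size (spl d b) = k.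
Proof. by rewrite size_map size_enum_ord. Qed.

Lemma extC b d e i j : d != e -> ext (ext b d i) e j = ext (ext b e j) d i.
Proof.
move=> de; congr pair; apply/funext => a /=; rewrite -!catA; congr cat.
by case: (eqVneq a d) => [->|_]; rewrite ?(negPf de) ?cats0.
Qed.

Lemma inb_ext p b d i :
  inb p (ext b d i) = inb p b && (p.2 d (size (b.2 d)) == i :> 'I_k).
Proof.
rewrite /inb /= -andbA; congr andb; apply/forallP/andP => [H|[/forallP H /eqP hi] e].
  split; first apply/forallP => e.
    have /eqP := H e; case: (eqVneq e d) => [->|_]; last by rewrite cats0 => ->.
    by rewrite cats1 size_rcons mkseqS => /rcons_inj[->].
  have /eqP := H d; rewrite eqxx cats1 size_rcons mkseqS => /rcons_inj[_ ->].
  exact: eqxx.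
case: (eqVneq e d) => [->|_]; last by rewrite cats0.
by rewrite cats1 size_rcons mkseqS hi (eqP (H d)).
Qed.

Lemma count_spl p d b : count (inb p) (spl d b) = inb p b.
Proof.
rewrite count_map (@eq_count _ _ (fun i => inb p b && (i == p.2 d (size (b.2 d)) :> 'I_k))).
  case: (inb p b) => /=; last by rewrite count_pred0.
  by rewrite (count_uniq_mem _ (enum_uniq _)) mem_enum.
by move=> i /=; rewrite inb_ext eq_sym.
Qed.

(** Covering and disjointness in one condition. A tiling is a list because the order of its bricks
    enters the transpositions and the pair sums below. *)
Definition tiling P := forall p, count (inb p) P = 1.

Lemma tiling_perm P Q : perm_eq P Q -> tiling P -> tiling Q.
Proof. by move=> /permP PQ tP p; rewrite -PQ. Qed.

Lemma tiling_spl d U b V : tiling (U ++ b :: V) <-> tiling (U ++ spl d b ++ V).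
Proof.
by split=> tP p; move: (tP p); rewrite !count_cat /= ?count_cat count_spl.
Qed.

Lemma tiling_mem P p : tiling P -> exists2 b, b \in P & inb p b.
Proof. by move=> tP; apply/hasP; rewrite has_count tP. Qed.

Lemma tiling_inj P p b c :
  tiling P -> b \in P -> c \in P -> inb p b -> inb p c -> b = c.
Proof.
move=> /(_ p) tP bP cP pb pc; apply: contraPeq tP => bc.
suff : 1 < count (inb p) P by case: count => [|[]].
rewrite (permP (perm_to_rem bP)) /= pb add1n ltnS -has_count.
apply/hasP; exists c => //; move: cP.
by rewrite (perm_mem (perm_to_rem bP)) inE eq_sym (negPf bc).
Qed.

End Tilings.

(** * Coordinatewise convergence *)

Section ProductTopology.
Local Open Scope classical_set_scope.

Lemma prod_topology_cvg (I : Type) (K : I -> topologicalType)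
    (F : set_system (prod_topology K)) (f : prod_topology K) : Filter F ->
  (forall i, (fun g : prod_topology K => g i) @ F --> f i) -> F --> f.
Proof.
move=> FF Hf; apply/cvg_sup => i U [V [[W oW <-] /= Wf] WU].
by apply: (filterS WU); apply: (Hf i W); apply: open_nbhs_nbhs.
Qed.

End ProductTopology.

(** * Exchanges of tilings as homeomorphisms *)

Section Carrying.
Local Open Scope classical_set_scope.
Variables n k r : nat.
Local Notation space := (thompson_space n k r).
Local Notation tails := ('I_n -> words_space k).
Local Notation brick := (brick n k r).
Implicit Types (b c : brick) (p q : space) (P Q : seq brick).

(** Agreement of the component and of the first N digits in each direction is a finite conjunction
    of conditions on discrete coordinates. *)
Lemma nbhs_uprefix N p : \forall q \near p, uprefix N q = uprefix N p.
Proof.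
have digit d i : \forall q \near p, q.2 d i = p.2 d i :> 'I_k.
  pose g (q : space) : discrete_topology 'I_k := q.2 d i.
  have cg : {for p, continuous g}.
    have c1 : {for p.2, continuous (proj d : {ptws 'I_n -> words_space k} -> words_space k)}.
      exact: proj_continuous.
    have c2 : {for p.2 d, continuous (proj i : words_space k -> discrete_topology 'I_k)}.
      exact: proj_continuous.
    have c3 : {for p, continuous (snd : space -> _)} by exact: cvg_snd.
    exact: (continuous_comp (continuous_comp c3 c1) c2).
  exact: (cg _ (discrete_set1 (g p))).
have comp : \forall q \near p, q.1 = p.1 :> 'I_r.
  have c1 : {for p, continuous (fst : space -> _)} by exact: cvg_fst.
  exact: (c1 _ (discrete_set1 p.1)).
have all_digits : \forall q \near p,
    forall d (i : 'I_N), (q : space).2 d (val i) = p.2 d (val i) :> 'I_k.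
  apply: (filter_forall (F := nbhs p)
    (f := fun d (q : space) => forall i : 'I_N, q.2 d (val i) = p.2 d (val i))) => d.
  apply: (filter_forall (F := nbhs p)
    (f := fun (i : 'I_N) (q : space) => q.2 d (val i) = p.2 d (val i))) => i.
  exact: digit.
apply: filterS (filterI comp all_digits) => q [q1 q2]; congr pair => //.
apply/funext => d; apply: (@eq_from_nth _ (p.2 d 0)); rewrite !size_mkseq // => i iN.
by rewrite !nth_mkseq //; exact: (q2 d (Ordinal iN)).
Qed.

Lemma uprefix_digit N p q d i : i < N -> uprefix N q = uprefix N p ->
  q.2 d i = p.2 d i.
Proof.
move=> iN [_ /(congr1 (fun f => nth (p.2 d 0) (f d) i))].
by rewrite !nth_mkseq.
Qed.

Lemma uprefix_le M N p q : M <= N -> uprefix N q = uprefix N p ->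
  uprefix M q = uprefix M p.
Proof.
move=> MN E; congr pair; first by case: E.
apply/funext => d; apply: (@eq_from_nth _ (p.2 d 0)); rewrite !size_mkseq // => i iM.
by rewrite !nth_mkseq // (uprefix_digit d _ E) // (leq_trans iM).
Qed.

(** Every coordinate of [h q] is locally constant in [q], being determined by finitely many digits
    of [q]. *)
Lemma uniformly_exchanges_continuous (h : space -> space) :
  uniformly_exchanges h -> continuous h.
Proof.
move=> [N hN] p; have [b hb] := hN p.
have hE q : uprefix N q = uprefix N p ->
    h q = brick_point b (fun d i => q.2 d (N + i)).
  by move=> E; rewrite -{1}(brick_point_prefix N q) E hb.
have coord1 : (fun q => (h q).1) @ p --> (h p).1.
  apply: cvg_near_cst; apply: filterS (nbhs_uprefix N p) => q /hE ->.
  by rewrite (hE p).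
have coord2 : (fun q => (h q).2 : {ptws 'I_n -> words_space k}) @ p --> (h p).2.
  apply: prod_topology_cvg => d; apply: prod_topology_cvg => i.
  (* Digit [i] of the image is either a letter of [b] or digit [N + (i - size (b.2 d))] of [q], so
     the first [(N + i).+1] digits suffice. *)
  apply: cvg_near_cst; apply: filterS (nbhs_uprefix (N + i).+1 p) => q qp.
  have le : N <= (N + i).+1 by lia.
  change ((h q).2 d i = (h p).2 d i).
  rewrite (hE q (uprefix_le le qp)) (hE p) //= /prepend.
  rewrite (uprefix_digit d (i := N + (i - size (b.2 d))) _ qp) //; lia.
have -> : h = (fun q => ((h q).1, (h q).2)) by apply/funext => q; case: (h q).
exact: cvg_pair coord1 coord2.
Qed.

Lemma tail_inK b x : tail_in b (brick_point b x) = x.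
Proof.
apply/funext => d; apply/funext => i /=.
by rewrite /tail_in /= /prepend nth_default ?leq_addr // addKn.
Qed.

Definition carry (h : space -> space) P Q :=
  size P = size Q /\ {in zip P Q, forall x, carries h x.1 x.2}.

Lemma inb_uprefix N p b : (forall d, size (b.2 d) <= N) -> inb p b ->
  uprefix N p = extend b (fun d => mkseq (tail_in b p d) (N - size (b.2 d))).
Proof. by move=> bN /brick_pointK {1}<-; rewrite prefix_long. Qed.

Lemma exists_depth P : exists N, forall b, b \in P -> forall d, size (b.2 d) <= N.
Proof.
elim: P => [|a P [N IH]]; first by exists 0.
exists (maxn N (\max_(d < n) size (a.2 d))) => b; rewrite inE.
move=> /orP[/eqP -> d|bP d]; last by rewrite leq_max IH.
by rewrite leq_max (leq_bigmax (F := fun d => size (a.2 d))) orbT.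
Qed.

(* When P is a tiling the filtered list is a singleton, so the default value p of
   head is never used. *)
Definition exchange_fun P Q p : space :=
  head p [seq brick_point x.2 (tail_in x.1 p) | x <- zip P Q & inb p x.1].

Lemma exchange_funE P Q p x : tiling P -> size P = size Q -> x \in zip P Q ->
  inb p x.1 -> exchange_fun P Q p = brick_point x.2 (tail_in x.1 p).
Proof.
move=> tP sPQ xPQ px; rewrite /exchange_fun.
have : size [seq x <- zip P Q | inb p x.1] = 1.
  rewrite size_filter -(tP p) -[in RHS](@unzip1_zip _ _ P Q) ?sPQ //.
  by rewrite count_map.
have : x \in [seq x <- zip P Q | inb p x.1] by rewrite mem_filter px.
by case: [seq _ <- _ | _] => [|y [|? ?]] //=; rewrite inE => /eqP ->.
Qed.

Lemma mem_zip1 P Q b : size P = size Q -> b \in P ->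
  exists c, (b, c) \in zip P Q.
Proof.
move=> sPQ; rewrite -{1}(@unzip1_zip _ _ P Q) ?sPQ // => /mapP[[b' c] bc /= ->].
by exists c.
Qed.

Lemma mem_zipC P Q b c : (b, c) \in zip P Q -> (c, b) \in zip Q P.
Proof.
elim: P Q => [|x P IH] [|y Q] //=; rewrite !inE.
by move=> /orP[/eqP[-> ->]|/IH ->]; rewrite ?eqxx // orbT.
Qed.

Lemma exchange_carry P Q : tiling P -> size P = size Q ->
  carry (exchange_fun P Q) P Q.
Proof.
move=> tP sPQ; split=> // x xPQ y.
by rewrite (exchange_funE tP sPQ xPQ) ?inb_point // tail_inK.
Qed.

Lemma exchange_funK P Q : tiling P -> tiling Q -> size P = size Q ->
  cancel (exchange_fun P Q) (exchange_fun Q P).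
Proof.
move=> tP tQ sPQ p; have [b bP pb] := tiling_mem p tP.
have [c bc] := mem_zip1 sPQ bP; rewrite (exchange_funE tP sPQ bc) //=.
rewrite (exchange_funE tQ (esym sPQ) (mem_zipC bc)) ?inb_point //=.
by rewrite tail_inK brick_pointK.
Qed.

(** Once [N] bounds the lengths of the words of [P], each uniform brick of depth [N] lies in one
    brick of [P] and inherits its canonical map. *)
Lemma carry_uniform h P Q : tiling P -> carry h P Q -> uniformly_exchanges h.
Proof.
move=> tP [sPQ hPQ]; have [N PN] := exists_depth P; exists N => p.
have [b bP pb] := tiling_mem p tP; have [c bc] := mem_zip1 sPQ bP.
rewrite (inb_uprefix (PN b bP) pb); eexists; apply: carries_extend.
exact: (hPQ _ bc).
Qed.

Lemma exchange_exists P Q : tiling P -> tiling Q -> size P = size Q ->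
  exists h : thompson n k r, carry h P Q.
Proof.
move=> tP tQ sPQ.
have cPQ := uniformly_exchanges_continuous (carry_uniform tP (exchange_carry tP sPQ)).
have cQP := uniformly_exchanges_continuous
  (carry_uniform tQ (exchange_carry tQ (esym sPQ))).
pose h := Homeo (exchange_funK tP tQ sPQ) (exchange_funK tQ tP (esym sPQ)) cPQ cQP.
have hT : h \in @thompson_pred n k r.
  apply/asboolP/uniform_brick_exchange; apply: (carry_uniform tP).
  exact: exchange_carry.
by exists (Thompson hT); exact: exchange_carry.
Qed.

End Carrying.

(** * Sequences of splits *)

Section Splits.
Variables (n k : nat) (E : Type) (exE : E -> 'I_n -> 'I_k -> E).

Definition gspl d x := [seq exE x d i | i <- enum 'I_k].

(** The middle list records the directions of the successive splits. The type [E] is arbitrary so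
    that pairs of bricks can be split simultaneously as well. *)
Inductive splits : seq E -> seq 'I_n -> seq E -> Prop :=
| splits_nil L : splits L [::] L
| splits_cons U x V d D L :
    splits (U ++ gspl d x ++ V) D L -> splits (U ++ x :: V) (d :: D) L.

Lemma splits_size L D L' : splits L D L' -> size L' + size D = size L + size D * k.
Proof.
elim=> {L D L'} [L|U x V d D L _ IH] /=; first by lia.
move: IH; rewrite !size_cat /= size_map size_enum_ord; lia.
Qed.

End Splits.

Lemma splits_map n k E E' (exE : E -> 'I_n -> 'I_k -> E) (exE' : E' -> 'I_n -> 'I_k -> E')
    (f : E -> E') : (forall x d i, f (exE x d i) = exE' (f x) d i) ->
  forall L D L', splits exE L D L' -> splits exE' (map f L) D (map f L').
Proof.
move=> fE L D L'; elim=> {L D L'} [L|U x V d D L _ IH]; first exact: splits_nil.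
rewrite map_cat /=; apply: splits_cons; move: IH; rewrite !map_cat.
by rewrite -map_comp (eq_map (g := fun i => exE' (f x) d i)) // => i /=.
Qed.

(** * Refinement to uniform depth, and rigidity of canonical maps *)

Section Refine.
Variables n k r : nat.
Local Notation space := (thompson_space n k r).
Local Notation tails := ('I_n -> words_space k).
Local Notation brick := (brick n k r).
Implicit Types (b c : brick) (p q : space) (P Q : seq brick).

Definition full M b := [forall d, size (b.2 d) == M].

Lemma splits_tiling P D Q : splits (@ext n k r) P D Q -> tiling P <-> tiling Q.
Proof.
by elim=> {P D Q} [//|U x V d D L _ <-]; apply: tiling_spl.
Qed.

Lemma size_ext b d i e : size ((ext b d i).2 e) = size (b.2 e) + (e == d).
Proof. by rewrite /= size_cat; case: eqP. Qed.

(** Split in any direction whose word is too short. The sum of [k.+1 ^ deficit] decreases, since one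
    term is replaced by k terms smaller by a factor k + 1. The map [f] selects the brick whose depth
    is controlled. *)
Lemma refine (E : eqType) (exE : E -> 'I_n -> 'I_k -> E) (f : E -> brick) M :
  (forall x d i, f (exE x d i) = ext (f x) d i) ->
  forall L, {in L, forall x d, size ((f x).2 d) <= M} ->
  exists D L', splits exE L D L' /\ {in L', forall x, full M (f x)}.
Proof.
move=> fE L.
pose deficit b := \sum_d (M - size (b.2 d)).
move: {2}(\sum_(x <- L) k.+1 ^ deficit (f x)).+1 (ltnSn (\sum_(x <- L) k.+1 ^ deficit (f x))).
move=> m; elim: m L => // m IH L mL dL.
have [/allP Lfull|/allPn[x xL xfull]] := boolP (all (fun x => full M (f x)) L).
  by exists [::], L; split=> //; apply: splits_nil.
move: xfull => /forallPn[d xd]; have {}xd : size ((f x).2 d) < M.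
  by rewrite ltn_neqAle xd dL.
case/splitPr: xL mL dL => U V mL dL.
have defE i : (deficit (f (exE x d i))).+1 = deficit (f x).
  rewrite fE /deficit (bigD1 d) //= [RHS](bigD1 d) //= -addSn; congr addn.
    by rewrite size_cat eqxx addn1 -subSn.
  by apply: eq_bigr => e /negPf ed; rewrite size_cat ed addn0.
have [|y|D [L' [sL L'full]]] := IH (U ++ gspl exE d x ++ V).
- rewrite ltnS in mL; apply: leq_trans mL; rewrite !big_cat big_cons /=.
  rewrite ltn_add2l -addSn leq_add2r big_map.
  rewrite (eq_bigr (fun=> k.+1 ^ (deficit (f x)).-1)); last first.
    by move=> i _; rewrite -(defE i).
  rewrite big_const_seq count_predT size_enum_ord iter_addn_0.
  (* A zero deficit contradicts [defE] when k is positive, and for k = 0 the left side vanishes. *)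
  case: (deficit (f x)) defE => [defE|t _] /=; last first.
    by rewrite expnS mulnC ltn_pmul2r // expn_gt0.
  have [->|k0] := posnP k; first by rewrite muln0.
  by have := defE (Ordinal k0).
- rewrite !mem_cat => /or3P[yU|/mapP[i _ ->]|yV] e.
  + by apply: dL; rewrite mem_cat yU.
  + rewrite fE size_ext; case: eqP => [->|_] /=; first by rewrite addn1.
    by rewrite addn0; apply: dL; rewrite mem_cat inE eqxx orbT.
  + by apply: dL; rewrite mem_cat inE yV !orbT.
- by exists (d :: D), L'; split=> //; apply: splits_cons.
Qed.

Lemma refine_bricks M P : (forall b, b \in P -> forall d, size (b.2 d) <= M) ->
  exists D P', splits (@ext n k r) P D P' /\ {in P', forall b, full M b}.
Proof. by move=> PM; apply: (@refine _ (@ext n k r) id). Qed.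

Lemma full_uprefix M b p : full M b -> inb p b -> b = uprefix M p.
Proof.
case: b => j w /forallP bM /andP[/eqP /= jp /forallP bp]; congr pair => //.
by apply/funext => d; rewrite /= -(eqP (bp d)) (eqP (bM d)).
Qed.

Hypothesis k2 : 2 <= k.

Let x0 : 'I_k := Ordinal (ltnW k2).
Let zeros : tails := fun _ _ => x0.

Lemma brick_inhabited b : exists p, inb p b.
Proof. by exists (brick_point b zeros); apply: inb_point. Qed.

Lemma tiling_uniq P : tiling P -> uniq P.
Proof.
move=> tP; apply: count_mem_uniq => b; have [p pb] := brick_inhabited b.
have : count_mem b P <= 1.
  by rewrite -(tP p); apply: sub_count => c /= /eqP ->.
have [bP|/count_memPn -> //] := boolP (b \in P).
by have : 0 < count_mem b P; [rewrite -has_count has_pred1 | case: count => [|[]]].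
Qed.

(** A brick of depth [M] is determined by any of its points, so both tilings consist of all bricks
    of that depth. *)
Lemma tiling_full_perm M P Q : tiling P -> tiling Q ->
  {in P, forall b, full M b} -> {in Q, forall b, full M b} -> perm_eq P Q.
Proof.
move=> tP tQ fP fQ; apply: uniq_perm; try exact: tiling_uniq.
have sub P' Q' : tiling Q' -> {in P', forall b, full M b} ->
    {in Q', forall b, full M b} -> {subset P' <= Q'}.
  move=> tQ' fP' fQ' b bP; have [p pb] := brick_inhabited b.
  have [c cQ pc] := tiling_mem p tQ'.
  by rewrite (full_uprefix (fP' b bP) pb) -(full_uprefix (fQ' c cQ) pc).
by move=> b; apply/idP/idP; apply: sub.
Qed.

(** Sizes of tilings agree modulo k - 1: a split adds k - 1 bricks, and both tilings refine to the
    same uniform one. *)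
Lemma tiling_size P Q : tiling P -> tiling Q ->
  exists i j, size P + i * k.-1 = size Q + j * k.-1.
Proof.
move=> tP tQ; have [N PN] := exists_depth (P ++ Q).
have [|D [P' [sP fP]]] := @refine_bricks N P.
  by move=> b bP; apply: PN; rewrite mem_cat bP.
have [|D' [Q' [sQ fQ]]] := @refine_bricks N Q.
  by move=> b bQ; apply: PN; rewrite mem_cat bQ orbT.
have ePQ : size P' = size Q'.
  apply: perm_size; apply: tiling_full_perm fP fQ.
    by apply/(splits_tiling sP).
  by apply/(splits_tiling sQ).
move: (splits_size sP) (splits_size sQ) => eP eQ.
have kE (m : nat) : m * k = m + m * k.-1 by rewrite -{1}(ltn_predK k2) mulnS.
by exists (size D), (size D'); move: eP eQ; rewrite !kE ePQ; lia.
Qed.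

Lemma prepend_inj (w w' : seq 'I_k) :
  (forall x : words_space k, prepend w x = prepend w' x) -> w = w'.
Proof.
wlog sw : w w' / size w <= size w'.
  by move=> H E; case: (leqP (size w) (size w')) => [|/ltnW] s; [exact: H|apply/esym/H].
move=> E.
have ww' : take (size w) w' = w.
  rewrite -(mkseq_prepend_take (fun=> x0) sw) -E mkseq_prepend_take //.
  exact: take_size.
case wE : (drop (size w) w') => [|a u].
  by rewrite -(cat_take_drop (size w) w') wE ww' cats0.
(* A tail starting with a letter other than the next letter of [w'] separates the two words. *)
have [y ya] : exists y : 'I_k, y != a.
  have [->|] := eqVneq a x0; last by exists x0; rewrite eq_sym.
  by exists (Ordinal k2).
have := congr1 (fun x => x (size w)) (E (fun=> y)).
rewrite -(cat_take_drop (size w) w') wE ww' /prepend nth_default // nth_cat ltnn subnn.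
by move=> /= ya'; rewrite ya' eqxx in ya.
Qed.

Lemma carries_inj (h : space -> space) b c c' : carries h b c -> carries h b c' -> c = c'.
Proof.
move=> hc hc'; have E x : brick_point c x = brick_point c' x by rewrite -hc -hc'.
case: c c' {hc hc'} E => [j w] [j' w'] E; congr pair; first by case: (E zeros).
apply/funext => d; apply: prepend_inj => x.
by case: (E (fun=> x)) => _ /(congr1 (fun f => f d)).
Qed.

Lemma carry_fun_inj (h h' : space -> space) P Q : tiling P ->
  carry h P Q -> carry h' P Q -> h =1 h'.
Proof.
move=> tP [sPQ hPQ] [_ h'PQ] p; have [b bP pb] := tiling_mem p tP.
have [c bc] := mem_zip1 sPQ bP.
by rewrite -(brick_pointK pb) (hPQ _ bc) (h'PQ _ bc).
Qed.

Lemma inb_carries (h : homeo space) b c q : carries h b c -> inb (h q) c = inb q b.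
Proof.
move=> hbc; apply/idP/idP => [qc|qb].
  have := brick_pointK qc; rewrite -hbc => /(can_inj (@homeo_funK _ h)) <-.
  exact: inb_point.
by rewrite -(brick_pointK qb) hbc inb_point.
Qed.

Lemma carry_tiling (h : homeo space) P Q : carry h P Q -> tiling P <-> tiling Q.
Proof.
move=> [sPQ hPQ].
suff cE q : count (inb (h q)) Q = count (inb q) P.
  split=> tPQ p; last by rewrite -cE tPQ.
  by rewrite -[p](homeo_invK h) cE tPQ.
elim: P Q sPQ hPQ => [|b P IH] [|c Q] //= [sPQ] hPQ.
rewrite (inb_carries q (hPQ (b, c) _)) ?inE ?eqxx //; congr addn.
by apply: IH => // x xPQ; apply: hPQ; rewrite inE xPQ orbT.
Qed.

Lemma carryM (g h : homeo space) P Q R : carry h P Q -> carry g Q R ->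
  carry (g * h)%g P R.
Proof.
case=> sQ hPQ [sR gQR]; split; first by rewrite sQ.
elim: P Q R sQ sR hPQ gQR => [|b P IH] [|c Q] [|a R] //= [sQ] [sR] hPQ gQR x.
rewrite inE => /orP[/eqP -> y /=|xPR]; last first.
  by apply: (IH Q R) xPR => // z zz; [apply: hPQ|apply: gQR]; rewrite inE zz orbT.
by rewrite (hPQ (b, c)) ?(gQR (c, a)) ?inE ?eqxx.
Qed.

Lemma carryV (h : homeo space) P Q : carry h P Q -> carry (h^-1)%g Q P.
Proof.
move=> [sPQ hPQ]; split=> // [[c b]] /mem_zipC /hPQ /= hbc x.
by rewrite -hbc; apply: homeo_funK.
Qed.

Lemma carry1 P : carry (1 : homeo space)%g P P.
Proof.
split=> // x; elim: P => //= b P IH; rewrite inE => /orP[/eqP -> //|]; exact: IH.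
Qed.

Lemma uprefix_extend M N p : M <= N ->
  uprefix N p = extend (uprefix M p) (fun d => mkseq (fun i => p.2 d (M + i)) (N - M)).
Proof.
move=> MN; rewrite -{1}(brick_point_prefix M p) prefix_long /= => [|d].
  by congr pair; apply/funext => d /=; rewrite size_mkseq.
by rewrite size_mkseq.
Qed.

(** Canonical maps restrict to smaller bricks, so every depth beyond [N] works; this freedom lets
    the depth meet other bounds too. *)
Lemma thompson_carry (h : thompson n k r) : exists N, forall M, N <= M ->
  forall P, tiling P -> {in P, forall b, full M b} -> exists Q, carry h P Q.
Proof.
have /asboolP/brick_exchange_uniform[N hN] : thompson_homeo h \in @thompson_pred n k r.
  by case: h.
exists N => M NM P tP fP.
have : {in P, forall b, exists c, carries h b c}.
  move=> b bP; have [p pb] := brick_inhabited b; have [c hc] := hN p.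
  rewrite (full_uprefix (fP b bP) pb) (uprefix_extend p NM).
  by eexists; apply: carries_extend hc.
elim: P {tP fP} => [|b P IH] hP; first by exists [::].
have [c hc] := hP b (mem_head _ _).
have [|Q [sQ hQ]] := IH; first by move=> a aP; apply: hP; rewrite inE aP orbT.
exists (c :: Q); split=> /=; first by rewrite sQ.
by move=> x; rewrite inE => /orP[/eqP -> //|]; apply: hQ.
Qed.

Lemma tiling_root : tiling [seq (j, fun=> [::]) : brick | j <- enum 'I_r].
Proof.
move=> p; rewrite count_map (@eq_count _ _ (pred1 p.1)).
  by rewrite (count_uniq_mem _ (enum_uniq _)) mem_enum.
move=> j /=; rewrite /inb /= eq_sym; case: eqP => //= _.
by apply/forallP.
Qed.

Lemma tiling_full M : exists2 P, tiling P & {in P, forall b, full M b}.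
Proof.
have [|D [P [sP fP]]] := @refine_bricks M [seq (j, fun=> [::]) : brick | j <- enum 'I_r].
  by move=> b /mapP[j _ ->].
by exists P => //; apply/(splits_tiling sP)/tiling_root.
Qed.

End Refine.

(** * The projection onto the abelianization *)

Section AbelianizationMap.
Local Open Scope ring_scope.
Local Open Scope quotient_scope.
Variable G : groupType.

Definition ab (x : G) : abelianization G := \pi_(abelianization G) x.

Lemma abM x y : ab (x * y)%g = ab x + ab y.
Proof. by rewrite /ab; exact: ab_add_morph. Qed.

Lemma ab1 : ab 1%g = 0.
Proof. by apply: (addIr (ab 1%g)); rewrite -abM mul1g add0r. Qed.

Lemma abV x : ab (x^-1)%g = - ab x.
Proof. by apply: (addIr (ab x)); rewrite -abM mulVg addNr ab1. Qed.

Lemma ab_surj a : exists x, ab x = a.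
Proof. by exists (repr a); rewrite /ab reprK. Qed.

End AbelianizationMap.

(** * Classes of exchanges between ordered tilings *)

Section Relation.
Local Open Scope ring_scope.
Variables n k r : nat.
Hypothesis k2 : (2 <= k)%N.
Local Notation space := (thompson_space n k r).
Local Notation brick := (brick n k r).
Local Notation T := (thompson n k r).
Local Notation Vab := (abelianization (thompson n k r)).
Implicit Types (b c : brick) (p q : space) (P Q R U V W : seq brick).

(* P is carried onto Q, brick by brick, by an element of class v. With at least
   three bricks, all transpositions of two bricks of a tiling are conjugate. *)
Definition exch P (v : Vab) Q :=
  [/\ tiling P, tiling Q, size P = size Q, (2 < size P)%N &
      exists2 h : T, carry h P Q & ab h = v].

Lemma exch_refl P : tiling P -> (2 < size P)%N -> exch P 0 P.
Proof. by move=> tP sP; split=> //; exists 1%g; [apply: carry1|apply: ab1]. Qed.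

Lemma exch_sym P v Q : exch P v Q -> exch Q (- v) P.
Proof.
move=> [tP tQ s s2 [h hPQ <-]]; split=> //; first by rewrite -s.
by exists (h^-1)%g; [apply: carryV|rewrite abV].
Qed.

Lemma exch_trans Q P u v R : exch P u Q -> exch Q v R -> exch P (u + v) R.
Proof.
move=> [tP tQ s s2 [h hPQ <-]] [_ tR s' _ [g gQR <-]]; split=> //; first by rewrite s.
exists (g * h)%g; last by rewrite abM addrC.
exact: carryM hPQ gQR.
Qed.

Lemma exch_ex P Q : tiling P -> tiling Q -> size P = size Q -> (2 < size P)%N ->
  exists v, exch P v Q.
Proof.
move=> tP tQ sPQ s2; have [h hPQ] := exchange_exists tP tQ sPQ.
by exists (ab h); split=> //; exists h.
Qed.

Lemma exch_uniq P Q u v : exch P u Q -> exch P v Q -> u = v.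
Proof.
move=> [tP tQ s s2 [h hPQ <-]] [_ _ _ _ [g gPQ <-]]; congr ab.
by apply: val_inj; apply: homeo_ext; apply: carry_fun_inj tP hPQ gPQ.
Qed.

Lemma exch_eq P Q u v : u = v -> exch P u Q -> exch P v Q.
Proof. by move=> ->. Qed.

Lemma exch_perm P v Q P' Q' : exch P v Q -> size P' = size Q' ->
  perm_eq (zip P Q) (zip P' Q') -> exch P' v Q'.
Proof.
move=> [tP tQ s s2 [h [_ hPQ] hv]] s' PQ.
have pP : perm_eq P P'.
  have := perm_map fst PQ; rewrite -/unzip1.
  by rewrite -!/(unzip1 _) !unzip1_zip ?s ?s'.
have pQ : perm_eq Q Q'.
  have := perm_map snd PQ.
  by rewrite -!/(unzip2 _) !unzip2_zip ?s ?s'.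
split=> //; [exact: tiling_perm tP|exact: tiling_perm tQ|by rewrite -(perm_size pP)|].
by exists h => //; split=> // x; rewrite -(perm_mem PQ); apply: hPQ.
Qed.

Lemma zip_spl d b c : zip (spl d b) (spl d c) = [seq (ext b d i, ext c d i) | i <- enum 'I_k].
Proof. by rewrite /spl; elim: (enum 'I_k) => //= i l ->. Qed.

(** The canonical map of a brick restricts to the canonical maps of its pieces, so the group element
    is unchanged. *)
Lemma exch_spl d U b V v U' b' V' : size U = size U' ->
  exch (U ++ b :: V) v (U' ++ b' :: V') ->
  exch (U ++ spl d b ++ V) v (U' ++ spl d b' ++ V').
Proof.
move=> sU [tP tQ s s2 [h [_ hPQ] hv]].
split; [exact/tiling_spl|exact/tiling_spl| | |exists h => //; split=> [|x]].
- by move: s; rewrite !size_cat /= !size_map; lia.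
- by move: s2; rewrite !size_cat /= size_map size_enum_ord; lia.
- by move: s; rewrite !size_cat /= !size_map; lia.
rewrite !zip_cat ?size_spl // zip_spl !mem_cat => /or3P[xU|/mapP[i _ -> /=]|xV].
- by apply: hPQ; rewrite zip_cat // mem_cat xU.
- by apply: carries_extend; apply: (hPQ (b, b')); rewrite zip_cat //= mem_cat inE eqxx orbT.
- by apply: hPQ; rewrite zip_cat //= mem_cat inE xV !orbT.
Qed.

End Relation.

(** * The class of a transposition and of a reordering *)

Section Transpositions.
Local Open Scope ring_scope.
Variables n k r : nat.
Hypotheses (n0 : (0 < n)%N) (k2 : (2 <= k)%N) (r0 : (0 < r)%N).
Local Notation space := (thompson_space n k r).
Local Notation brick := (brick n k r).
Local Notation Vab := (abelianization (thompson n k r)).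
Implicit Types (b c : brick) (p q : space) (P Q R U V W : seq brick) (u v : Vab).

Let d0 : 'I_n := Ordinal n0.

Lemma tiling_size_gt0 P : tiling P -> (0 < size P)%N.
Proof.
move=> tP; pose b : brick := (Ordinal r0, fun=> [::]).
have [p _] := brick_inhabited k2 b; have [c] := tiling_mem p tP.
by case: P tP.
Qed.

Lemma large_tiling : exists2 P : seq brick, tiling P & (2 < size P)%N.
Proof.
have [P tP _] := @tiling_full n k r 0.
have := tiling_size_gt0 tP; case: P tP => // b P tP _.
have k0 : (0 < k)%N by apply: ltnW.
have t1 : tiling (spl d0 b ++ P) by apply/(tiling_spl d0 [::]).
have := size_spl d0 b; case E : (spl d0 b) t1 => [|c S] t1 /= sS.
  by move: k2; rewrite -sS.
exists (spl d0 c ++ (S ++ P)); first by apply/(tiling_spl d0 [::]).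
by rewrite !size_cat size_spl; lia.
Qed.

(** Splitting a brick of [V], which the transposition fixes, leaves the group element unchanged; [V]
    is nonempty since there are at least three bricks. *)
Lemma exch_swap_grow a b V u m : exch [:: a, b & V] u [:: b, a & V] ->
  exists2 V', size V' = (size V + m * k.-1)%N & exch [:: a, b & V'] u [:: b, a & V'].
Proof.
elim: m V => [|m IH] V rV; first by exists V; rewrite ?mul0n ?addn0.
case: V rV => [[]//|c V] rV.
have rV' := @exch_spl _ _ _ k2 d0 [:: a; b] c V u [:: b; a] c V erefl rV.
have [V' sV' rV''] := IH _ rV'; exists V' => //.
by rewrite sV' size_cat size_spl mulSn /=; lia.
Qed.

(** Transpositions in tilings of equal size are conjugate, hence have the same class; the sizes are
    first made equal by splitting. *)
Lemma exch_swap_uniq a b V a' b' V' u u' :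
  exch [:: a, b & V] u [:: b, a & V] -> exch [:: a', b' & V'] u' [:: b', a' & V'] ->
  u = u'.
Proof.
move=> ru ru'.
have [i [j E]] : exists i j, (size V + i * k.-1 = size V' + j * k.-1)%N.
  case: ru ru' => tP _ _ _ _ [tQ _ _ _ _].
  by have [i [j /= E]] := tiling_size k2 tP tQ; exists i, j; lia.
have [W sW {}ru] := exch_swap_grow i ru.
have [W' sW' {}ru'] := exch_swap_grow j ru'.
have sWW' : size W = size W' by rewrite sW sW'.
have [tP _ _ sP _] := ru; have [tP' _ _ _ _] := ru'.
(* The element of class [w] conjugates one transposition into the other. *)
have [|w rw] := @exch_ex _ _ _ [:: a, b & W] [:: a', b' & W'] tP tP' _ sP.
  by rewrite /= sWW'.
have rw' : exch [:: b, a & W] w [:: b', a' & W'].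
  apply: (exch_perm rw); first by rewrite /= sWW'.
  by apply/permPl/(perm_catCA [:: _] [:: _]).
have := exch_trans (exch_trans (exch_sym rw) ru) rw'.
by move/exch_uniq => /(_ _ ru') <-; rewrite addrAC addNr add0r.
Qed.

(** For n, r >= 1 and k >= 2 the default 0 is not reached: [large_tiling] and [exch_ex] provide a
    transposition. *)
Definition transp_class : Vab :=
  xget 0 [set v | exists a b V, exch [:: a, b & V] v [:: b, a & V]]%classic.
Local Notation sw := transp_class.

Lemma exch_swap U a b V : tiling (U ++ [:: a, b & V]) ->
  (2 < size (U ++ [:: a, b & V]))%N ->
  exch (U ++ [:: a, b & V]) sw (U ++ [:: b, a & V]).
Proof.
move=> tP sP.
have front (c e : brick) : perm_eq (U ++ [:: c, e & V]) [:: c, e & U ++ V].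
  exact/permPl/(perm_catCA _ [:: c; e]).
have p1 : perm_eq [:: a, b & U ++ V] [:: b, a & U ++ V].
  exact/permPl/(perm_catCA [:: _] [:: _]).
have t1 := tiling_perm (front a b) tP.
have [|v rv] := exch_ex t1 (tiling_perm p1 t1) erefl.
  by rewrite -(perm_size (front a b)).
have swv : sw = v.
  rewrite /transp_class; case: xgetP => [w _ [a' [b' [V' rw]]]|/(_ v)[]].
    exact: exch_swap_uniq rw rv.
  by exists a, b, (U ++ V).
rewrite swv; apply: (exch_perm rv); first by rewrite !size_cat.
by rewrite /= !zip_cat // perm_sym; apply/permPl/(perm_catCA _ [:: _; _]).
Qed.

Lemma transp_class2 : sw *+ 2 = 0.
Proof.
have [[|a [|b V]] // tP sP] := large_tiling.
have t' : tiling [:: b, a & V].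
  by apply: tiling_perm tP; apply/permPl/(perm_catCA [:: _] [:: _]).
have := exch_trans (exch_swap (U := [::]) tP sP) (exch_swap (U := [::]) t' sP).
by move/exch_uniq/(_ (exch_refl tP sP)); rewrite mulr2n.
Qed.

Lemma transp_odd m : sw *+ m = sw *+ odd m.
Proof.
by rewrite -{1}(odd_double_half m) mulrnDr -mul2n mulrnA transp_class2 mul0rn addr0.
Qed.

Lemma exch_tiling P v Q : exch P v Q ->
  [/\ tiling P, tiling Q, (2 < size P)%N & (2 < size Q)%N].
Proof. by case=> tP tQ s s2 _; split=> //; rewrite -s. Qed.

Lemma exch_move U a W V : tiling (U ++ a :: W ++ V) ->
  (2 < size (U ++ a :: W ++ V))%N ->
  exch (U ++ a :: W ++ V) (sw *+ size W) (U ++ W ++ a :: V).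
Proof.
elim: W U => [|b W IH] U tP sP; first by rewrite mulr0n; exact: exch_refl.
have r1 := exch_swap tP sP; have [_ t1 _ s1] := exch_tiling r1.
have := IH (rcons U b); rewrite -cats1 -!catA /= => /(_ t1 s1) r2.
by rewrite mulrS; apply: exch_trans r1 r2.
Qed.

(** Each brick of [A] passes each brick of [B] once. *)
Lemma exch_block U A B V : tiling (U ++ A ++ B ++ V) ->
  (2 < size (U ++ A ++ B ++ V))%N ->
  exch (U ++ A ++ B ++ V) (sw *+ (size A * size B)) (U ++ B ++ A ++ V).
Proof.
elim: A U => [|a A IH] U tP sP; first by rewrite mul0n mulr0n; exact: exch_refl.
have := IH (rcons U a); rewrite -cats1 -!catA /= => /(_ tP sP) r1.
have [_ t1 _ s1] := exch_tiling r1.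
by rewrite mulSn addnC mulrnDr; apply: exch_trans r1 (exch_move t1 s1).
Qed.

(** After splitting both transposed bricks, the same element exchanges two blocks of k bricks, which
    takes k^2 transpositions, an even number. *)
Lemma transp_even : ~~ odd k -> sw = 0.
Proof.
move=> k_even.
have [[|a [|b V]] // tP sP] := large_tiling.
have r1 := @exch_spl _ _ _ k2 d0 [::] _ _ _ [::] _ _ erefl (exch_swap (U := [::]) tP sP).
have {r1} := @exch_spl _ _ _ k2 d0 _ _ _ _ _ _ _ _ r1.
rewrite !size_spl => /(_ erefl) r2; have [t2 _ s2 _] := exch_tiling r2.
have := exch_uniq r2 (exch_block (U := [::]) t2 s2).
by rewrite !size_spl transp_odd oddM (negPf k_even).
Qed.

Lemma transp_mulSk : sw *+ k.+1 = 0.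
Proof.
by rewrite transp_odd /=; case: (boolP (odd k)) => //= /transp_even ->; rewrite mul0rn.
Qed.

Lemma exch_reverse U A W B V : tiling (U ++ A ++ W ++ B ++ V) ->
  (2 < size (U ++ A ++ W ++ B ++ V))%N ->
  exch (U ++ A ++ W ++ B ++ V) (sw *+ (size A * (size W + size B) + size W * size B))
       (U ++ B ++ W ++ A ++ V).
Proof.
move=> tP sP.
have := exch_block (U := U) (A := A) (B := W ++ B) (V := V).
rewrite -!catA (size_cat W B) => /(_ tP sP) r1; have [_ t1 _ s1] := exch_tiling r1.
by rewrite mulrnDr; apply: exch_trans r1 (exch_block t1 s1).
Qed.

(* The two splittings differ by a transposition of b and c and by a permutation
   moving the k pieces of c past b: up to an even number, a multiple of k + 1
   transpositions, and k + 1 is even unless transpositions have trivial class. *)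
Lemma exch_spl_pos d U b W c V : tiling (U ++ b :: W ++ c :: V) ->
  (2 < size (U ++ b :: W ++ c :: V))%N ->
  exch (U ++ spl d b ++ W ++ c :: V) 0 (U ++ b :: W ++ spl d c ++ V).
Proof.
move=> tP sP.
have := exch_reverse (U := U) (A := [:: b]) (B := [:: c]) tP sP.
move/(exch_spl k2 d (erefl (size U))) => r1; have [_ t1 _ s1] := exch_tiling r1.
have := exch_reverse (U := U) (A := spl d c) (B := [:: b]) (W := W) (V := V).
move=> /(_ t1 s1) r2.
apply: exch_eq (exch_trans r1 r2); rewrite -mulrnDr /= size_spl.
have -> : (1 * (size W + 1) + size W * 1 + (k * (size W + 1) + size W * 1) =
  k.+1 * (size W + 1) + 2 * size W)%N by lia.
by rewrite mulrnDr !mulrnA transp_mulSk transp_class2 !mul0rn addr0.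
Qed.

(** Each block [g y] moves left past the entries [f y'] of all later [y'], which takes m
    transpositions for each pair of positions. *)
Lemma exch_interleave (X : Type) (f : X -> brick) (g : X -> seq brick) m ys U V :
  (forall y, size (g y) = m) ->
  tiling (U ++ map f ys ++ flatten (map g ys) ++ V) ->
  (2 < size (U ++ map f ys ++ flatten (map g ys) ++ V))%N ->
  exch (U ++ map f ys ++ flatten (map g ys) ++ V) (sw *+ (m * 'C(size ys, 2)))
       (U ++ flatten [seq f y :: g y | y <- ys] ++ V).
Proof.
move=> gm; elim: ys U => [|y ys IH] U tP sP.
  by rewrite bin0n muln0 mulr0n; apply: exch_refl.
move: tP sP; rewrite /= -!catA => tP sP.
have := exch_block (U := rcons U (f y)) (A := map f ys) (B := g y)
  (V := flatten (map g ys) ++ V).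
rewrite -cats1 -!catA /= => /(_ tP sP) r1; have [_ t1 _ s1] := exch_tiling r1.
have := IH (U ++ f y :: g y); rewrite -!catA /= => /(_ t1 s1) r2.
apply: exch_eq (exch_trans r1 r2).
by rewrite -mulrnDr size_map gm binS bin1 mulnDr addnC (mulnC m (size ys)).
Qed.

(** Transposing an array creates one inversion for each pair of rows and pair of columns. In the
    induction the first row is interleaved into the transpose of the others. *)
Lemma exch_transpose (X Y : Type) (f : X -> Y -> brick) xs ys U V :
  tiling (U ++ [seq f x y | x <- xs, y <- ys] ++ V) ->
  (2 < size (U ++ [seq f x y | x <- xs, y <- ys] ++ V))%N ->
  exch (U ++ [seq f x y | x <- xs, y <- ys] ++ V)
       (sw *+ ('C(size xs, 2) * 'C(size ys, 2)))
       (U ++ [seq f x y | y <- ys, x <- xs] ++ V).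
Proof.
elim: xs U => [|x xs IH] U tP sP.
  rewrite bin0n mulr0n; have -> : [seq f x y | y <- ys, x <- [::]] = [::].
    by elim: ys {tP sP}.
  exact: exch_refl.
move: tP sP; rewrite /= -!catA => tP sP.
have := IH (U ++ map (f x) ys); rewrite -!catA => /(_ tP sP) r1.
have [_ t1 _ s1] := exch_tiling r1.
have gm y : size [seq f x' y | x' <- xs] = size xs by rewrite size_map.
apply: exch_eq (exch_trans r1 (exch_interleave gm t1 s1)).
by rewrite -mulrnDr binS bin1 mulnDl.
Qed.

(** Selection sort: the brick due next is moved to the front of the unsorted part, behind the
    settled prefix [W]. *)
Lemma exch_perm_eq P Q : perm_eq P Q -> tiling P -> (2 < size P)%N ->
  exists m, exch P (sw *+ m) Q.
Proof.
suff H W : perm_eq P Q -> tiling (W ++ P) -> (2 < size (W ++ P))%N ->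
  exists m, exch (W ++ P) (sw *+ m) (W ++ Q) by apply: (H [::]).
elim: Q P W => [|a Q IH] P W PQ tP sP.
  move/perm_nilP: PQ tP sP => -> tP sP.
  by exists 0; rewrite mulr0n; apply: exch_refl.
have aP : a \in P by rewrite (perm_mem PQ) mem_head.
case/splitPr: aP PQ tP sP => U V PQ tP sP.
have UVQ : perm_eq (U ++ V) Q.
  by rewrite -(perm_cons a) -(permPr PQ) perm_sym; apply/permPl/(perm_catCA U [:: a]).
have := exch_block (U := W) (A := U) (B := [:: a]) (V := V) tP sP => /= r1.
have [_ t1 _ s1] := exch_tiling r1.
have := IH _ (rcons W a) UVQ; rewrite -cats1 -!catA => /(_ t1 s1)[m r2].
by exists (size U * 1 + m)%N; rewrite mulrnDr; apply: exch_trans r1 r2.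
Qed.

End Transpositions.

(** * Baker maps and generators of the abelianization *)

Section Baker.
Local Open Scope ring_scope.
Variables n k r : nat.
Hypotheses (n0 : (0 < n)%N) (k2 : (2 <= k)%N) (r0 : (0 < r)%N).
Local Notation space := (thompson_space n k r).
Local Notation brick := (brick n k r).
Local Notation Vab := (abelianization (thompson n k r)).
Implicit Types (b c : brick) (p q : space) (P Q R U V W : seq brick) (u v : Vab).

Local Notation d0 := (Ordinal n0).
Local Notation sw := (transp_class n k r).

(** A normal form for splits: by [exch_split_head0] the position of the split brick is irrelevant up
    to class 0. *)
Definition split_head d P := if P is b :: V then spl d b ++ V else [::].

Lemma exch_split_head d P v Q : exch P v Q -> exch (split_head d P) v (split_head d Q).
Proof.
case: P Q => [|b P] [|c Q] // r1; try by case: r1.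
exact: (@exch_spl _ _ _ k2 d [::] _ _ _ [::] _ _ erefl r1).
Qed.

Lemma exch_split_head0 d U b V : tiling (U ++ b :: V) ->
  (2 < size (U ++ b :: V))%N ->
  exch (split_head d (U ++ b :: V)) 0 (U ++ spl d b ++ V).
Proof.
case: U => [|a U] tP sP.
  exact: (@exch_split_head d (b :: V) 0 (b :: V) (exch_refl tP sP)).
by rewrite /=; apply: (exch_spl_pos n0 k2 r0 d (U := [::])).
Qed.

Lemma exch_iter_split_head d m P v Q : exch P v Q ->
  exch (iter m (split_head d) P) v (iter m (split_head d) Q).
Proof. by move=> r1; elim: m => //= m; apply: exch_split_head. Qed.

Lemma exch_trans0 P Q R v : exch P v Q -> exch Q 0 R -> exch P v R.
Proof. by move=> r1 r2; apply: exch_eq (exch_trans r1 r2); rewrite addr0. Qed.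

Lemma exch_0sym P Q : exch P 0 Q -> exch Q 0 P.
Proof. by move=> r1; apply: exch_eq (exch_sym r1); rewrite oppr0. Qed.

(** The split in direction [d] is moved to the second brick, and splits of distinct bricks
    commute. *)
Lemma exch_split_headC d e P : tiling P -> (2 < size P)%N ->
  exch (split_head d (split_head e P)) 0 (split_head e (split_head d P)).
Proof.
case: P => [|a [|b V]] // tP sP.
have r1 := exch_split_head0 d (U := [:: a]) tP sP.
apply: (exch_trans0 _ (exch_0sym (exch_split_head e r1))).
have [t1 _ s1 _] := exch_tiling (exch_split_head e (exch_refl tP sP)).
exact: (exch_split_head0 d (U := spl e a) t1 s1).
Qed.

Lemma size_split_head d P : (0 < size P)%N -> size (split_head d P) = (size P + k.-1)%N.
Proof. by case: P => // b P _; rewrite /= size_cat size_spl addSnnS (ltn_predK k2) addnC. Qed.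

Lemma size_iter_split_head d P m : (0 < size P)%N ->
  size (iter m (split_head d) P) = (size P + m * k.-1)%N.
Proof.
move=> P0; elim: m => [|m IH] /=; first by rewrite mul0n addn0.
by rewrite size_split_head IH ?ltn_addr // mulSn -addnA (addnC (m * _)%N).
Qed.

(* The baker map turns the k slices of a brick in direction d0 into its k slices
   in direction d; its class does not depend on the tiling (exch_baker_uniq). *)
Definition baker_class d : Vab :=
  xget 0 [set v | exists P, [/\ tiling P, (2 < size P)%N &
                      exch (split_head d0 P) v (split_head d P)]]%classic.

(** Head splits in direction [d0] make [P] and [Q] equally large without changing the two classes.
    An exchange of class [w] between them keeps this class after both heads are split, and [w]
    cancels. *)
Lemma exch_baker_uniq d P Q u v :
  tiling P -> (2 < size P)%N -> tiling Q -> (2 < size Q)%N ->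
  exch (split_head d0 P) u (split_head d P) ->
  exch (split_head d0 Q) v (split_head d Q) -> u = v.
Proof.
move=> tP sP tQ sQ.
have [i [j E]] := tiling_size k2 tP tQ.
have grow m R w : tiling R -> (2 < size R)%N ->
  exch (split_head d0 R) w (split_head d R) ->
  exch (split_head d0 (iter m (split_head d0) R)) w (split_head d (iter m (split_head d0) R)).
- move=> tR sR rR; elim: m => //= m IH.
  have [tm _ sm _] := exch_tiling (exch_iter_split_head d0 m (exch_refl tR sR)).
  exact: exch_trans0 (exch_split_head d0 IH) (exch_split_headC _ _ tm sm).
move=> /(grow i _ _ tP sP) r1 /(grow j _ _ tQ sQ) r2.
have [tP' _ sP' _] := exch_tiling (exch_iter_split_head d0 i (exch_refl tP sP)).
have [tQ' _ sQ' _] := exch_tiling (exch_iter_split_head d0 j (exch_refl tQ sQ)).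
have [|w rw] := exch_ex tP' tQ' _ sP'.
  by rewrite !size_iter_split_head ?E //; lia.
have r3 := exch_trans (exch_split_head d0 rw) r2.
have := exch_trans r1 (exch_split_head d rw) => /exch_uniq/(_ r3)/eqP.
by rewrite addrC (inj_eq (addrI w)) => /eqP.
Qed.

Lemma exch_baker d P : tiling P -> (2 < size P)%N ->
  exch (split_head d0 P) (baker_class d) (split_head d P).
Proof.
move=> tP sP; have exP e := exch_split_head e (exch_refl tP sP).
have [v rv] : exists v, exch (split_head d0 P) v (split_head d P).
  have [t0 _ s0 _] := exch_tiling (exP d0); have [td _ _ _] := exch_tiling (exP d).
  by apply: exch_ex; rewrite // !size_split_head //; lia.
suff -> : baker_class d = v by [].
rewrite /baker_class; case: xgetP => [w _ [Q [tQ sQ rw]]|/(_ v)[]]; last by exists P.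
exact: exch_baker_uniq tQ sQ tP sP rw rv.
Qed.

Lemma baker_class0 : baker_class d0 = 0.
Proof.
have [P tP sP] := large_tiling n0 k2 r0.
exact: exch_uniq (exch_baker d0 tP sP) (exch_split_head d0 (exch_refl tP sP)).
Qed.

(** A split in direction d is a head split in direction [d0] followed by a baker map, up to class
    0. *)
Lemma exch_splits P D Q : splits (@ext n k r) P D Q -> tiling P -> (2 < size P)%N ->
  exch (iter (size D) (split_head d0) P) (\sum_(d <- D) baker_class d) Q.
Proof.
elim=> {P D Q} [P|U b V d D Q _ IH] tP sP; first by rewrite big_nil; apply: exch_refl.
have r1 := exch_split_head0 d tP sP; have [_ t1 _ s1] := exch_tiling r1.
rewrite big_cons [size _]/= iterSr.
have r2 := exch_trans0 (exch_baker d tP sP) r1.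
exact: exch_trans (exch_iter_split_head d0 (size D) r2) (IH t1 s1).
Qed.

Lemma splits_nseq e U X V : splits (@ext n k r) (U ++ X ++ V) (nseq (size X) e)
  (U ++ flatten [seq spl e x | x <- X] ++ V).
Proof.
elim: X U => [|x X IH] U /=; first exact: splits_nil.
by apply: splits_cons; have := IH (U ++ spl e x); rewrite -!catA.
Qed.

Lemma splits_grid d e a V : splits (@ext n k r) (a :: V) (d :: nseq k e)
  ([seq ext (ext a d i) e j | i <- enum 'I_k, j <- enum 'I_k] ++ V).
Proof.
apply: (@splits_cons _ _ _ _ [::]) => /=.
have := splits_nseq e [::] (spl d a) V; rewrite size_spl /=.
by rewrite /spl -map_comp.
Qed.

(* Cut a brick into k x k pieces, row by row or column by column: the two orders
   of the pieces differ by a transposition of a k x k array. *)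
Lemma baker_class_relation d e : d != e ->
  baker_class d *+ k.-1 = baker_class e *+ k.-1 + sw *+ 'C(k, 2).
Proof.
move=> de; have [[|a V] // tP sP] := large_tiling n0 k2 r0.
have r1 := exch_splits (splits_grid e d a V) tP sP.
have r2 := exch_splits (splits_grid d e a V) tP sP.
have [_ t1 _ s1] := exch_tiling r1.
have := exch_transpose n0 k2 r0 (f := fun i j => ext (ext a e i) d j) (U := [::]) t1 s1.
have -> : [seq ext (ext a e i) d j | j <- enum 'I_k, i <- enum 'I_k] =
          [seq ext (ext a d j) e i | j <- enum 'I_k, i <- enum 'I_k].
  by apply: eq_allpairs => // j i; apply: extC; rewrite eq_sym.
rewrite /= => r3; move: r1 r2; rewrite /= !size_nseq => r1 r2.
have := exch_uniq (exch_trans r1 r3) r2.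
rewrite !big_cons !big_nseq !iter_addr_0 size_enum_ord.
(* The array transposition contributes the square of C(k, 2), which has the parity of C(k, 2). *)
rewrite transp_odd // oddM andbb -transp_odd //.
have mulk (x : Vab) : x *+ k = x + x *+ k.-1 by rewrite -mulrS (ltn_predK k2).
rewrite !mulk => E; have {}E : baker_class d *+ k.-1 + sw *+ 'C(k, 2) = baker_class e *+ k.-1.
  apply: (addrI (baker_class e + baker_class d)); rewrite !addrA in E *.
  by rewrite E (addrC (baker_class e)).
by rewrite -E -addrA -mulrnDr addnn -mul2n mulrnA transp_class2 // mul0rn addr0.
Qed.

Lemma exch_splits_zip L D L' v :
  splits (fun x d i => (ext x.1 d i, ext x.2 d i)) L D L' ->
  exch (unzip1 L) v (unzip2 L) -> exch (unzip1 L') v (unzip2 L').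
Proof.
elim=> {L D L'} // U x V d D L _ IH r1; apply: IH; move: r1.
rewrite /unzip1 /unzip2 !map_cat /= => r1.
have sU : size (map fst U) = size (map snd U) by rewrite !size_map.
set W1 := map fst (gspl _ _ _); have -> : W1 = spl d x.1 by rewrite /W1 /gspl -[LHS]map_comp.
set W2 := map snd (gspl _ _ _); have -> : W2 = spl d x.2 by rewrite /W2 /gspl -[LHS]map_comp.
exact: (exch_spl k2 d sU r1).
Qed.

(** Let h carry [P] onto [Q]. Refining the pairs until the range has uniform depth, and [P] alone to
    the same depth, gives tilings equal up to order. Comparing both with head splits of [P] in
    direction [d0] expresses h by baker maps and transpositions. *)
Lemma ab_generated (x : Vab) : exists (D D' : seq 'I_n) (m : nat),
  size D = size D' /\ x =
    \sum_(d <- D) baker_class d - \sum_(d <- D') baker_class d + sw *+ m.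
Proof.
have [h <-] := ab_surj x.
have [N hN] := thompson_carry k2 h.
have [P0 tP0 sP0] := large_tiling n0 k2 r0.
have [M PM] := exists_depth P0.
(* The depth is at least [M], so that [P0] can be refined to it, and at least [N], so that [h] acts
   canonically on the result. *)
have [|D0 [P [sP fP]]] := @refine_bricks _ _ _ (maxn M N) P0.
  by move=> b bP d; rewrite leq_max PM.
have tP : tiling P by apply/(splits_tiling sP).
have [Q hPQ] := hN _ (leq_maxr M N) P tP fP.
have {}sP : (2 < size P)%N.
  by have := splits_size sP; have : (size D0 <= size D0 * k)%N; [rewrite leq_pmulr|]; lia.
have tQ := (carry_tiling hPQ).1 tP.
have r1 : exch P (ab h) Q by split=> //; [case: hPQ|exists h].
have [M' PQM] := exists_depth (P ++ Q).
have sPQ : size P = size Q by case: hPQ.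
have [||D [L [sL fL]]] := @refine n k r _ (fun x d i => (ext x.1 d i, ext x.2 d i)) snd M' _
    (zip P Q).
- by [].
- move=> z zPQ d; apply: PQM; rewrite mem_cat.
  by rewrite -[X in _ || (_ \in X)](@unzip2_zip _ _ P Q) ?sPQ // map_f ?orbT.
have [|D' [P' [sP' fP']]] := @refine_bricks _ _ _ M' P.
  by move=> b bP d; apply: PQM; rewrite mem_cat bP.
have r2 : exch (unzip1 L) (ab h) (unzip2 L).
  by apply: exch_splits_zip sL _; rewrite unzip1_zip ?unzip2_zip ?sPQ.
have s1 : splits (@ext n k r) (unzip1 (zip P Q)) D (unzip1 L).
  by apply: splits_map sL.
rewrite unzip1_zip ?sPQ // in s1.
have r3 := exch_splits s1 tP sP; have r4 := exch_splits sP' tP sP.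
have [t2 _ _ _ _] := r2; have [_ t3 _ s3] := exch_tiling r2.
have [_ t4 _ _] := exch_tiling r4.
have pP : perm_eq (unzip2 L) P'.
  by apply: (tiling_full_perm k2 t3 t4) fP' => _ /mapP[z zL ->]; apply: fL.
have [m r5] := exch_perm_eq n0 k2 r0 pP t3 s3.
have r6 := exch_trans (exch_trans r3 r2) r5.
(* Both refinements of [P] end with the same number of bricks, and each split adds k - 1. *)
have sDD : size D = size D'.
  have e1 : (size (unzip1 L) + size D = size P + size D * k)%N := splits_size s1.
  have e2 : (size P' + size D' = size P + size D' * k)%N := splits_size sP'.
  have e3 : size (unzip1 L) = size P'.
    by rewrite -(perm_size pP) /unzip1 /unzip2 !size_map.
  have kE (i : nat) : (i * k = i + i * k.-1)%N by rewrite -{1}(ltn_predK k2) mulnS.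
  have : (size D * k.-1 = size D' * k.-1)%N by move: e1 e2; rewrite !kE e3; lia.
  by move/eqP; rewrite eqn_pmul2r ?ltn_predRL // => /eqP.
exists D', D, m; split=> //; rewrite sDD in r6.
have <- := exch_uniq r6 r4.
rewrite -!addrA (addrCA (sw *+ m)) -mulrnDr addnn -mul2n mulrnA transp_class2 // mul0rn addr0.
by rewrite addrCA subrr addr0.
Qed.

End Baker.

(** * Sums of parities over lists and over ordered pairs of entries *)

Lemma big_addb_odd (I : Type) (l : seq I) (F : I -> nat) :
  \big[addb/false]_(i <- l) odd (F i) = odd (\sum_(i <- l) F i).
Proof. by rewrite (big_morph odd oddD (erefl : odd 0 = false)). Qed.

Lemma big_addb_const (I : Type) (l : seq I) (c : bool) :
  \big[addb/false]_(i <- l) c = odd (size l) && c.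
Proof.
elim: l => [|i l IH]; rewrite ?big_nil ?big_cons //= IH.
by case: odd; rewrite ?addbb ?addbF.
Qed.

Lemma big_addb_const_ord (m : nat) (c : bool) :
  \big[addb/false]_(i < m) c = odd m && c.
Proof. by rewrite -(big_mkord xpredT (fun=> c)) big_addb_const size_iota subn0. Qed.

Section PairSum.
Variable E : eqType.
Implicit Types (g : E -> E -> bool) (L U V : seq E).

Fixpoint psum g L : bool :=
  if L is x :: L' then (\big[addb/false]_(y <- L') g x y) (+) psum g L' else false.

Lemma psum_cat g U V : psum g (U ++ V) =
  psum g U (+) psum g V (+) \big[addb/false]_(x <- U) \big[addb/false]_(y <- V) g x y.
Proof.
elim: U => [|x U IH] /=; first by rewrite big_nil addbF.
rewrite IH big_cat big_cons /= -!addbA; congr addb; rewrite addbCA; congr addb.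
by rewrite addbCA.
Qed.

Lemma psum_addb g g' L : psum (fun x y => g x y (+) g' x y) L = psum g L (+) psum g' L.
Proof. by elim: L => //= x L ->; rewrite big_split /= addbACA. Qed.

Lemma psum_perm g L L' : {in L &, symmetric g} -> perm_eq L L' -> psum g L = psum g L'.
Proof.
elim: L L' => [|x L IH] L' gS LL'; first by rewrite perm_sym in LL'; move/perm_nilP: LL' => ->.
have xL' : x \in L' by rewrite -(perm_mem LL') mem_head.
case/splitPr: xL' LL' => U V LL'.
have LUV : perm_eq L (U ++ V).
  by rewrite -(perm_cons x) (permPl LL'); apply/permPl/(perm_catCA U [:: x]).
have gS' : {in L &, symmetric g} by move=> y z yL zL; apply: gS; rewrite inE ?yL ?zL orbT.
rewrite /= (IH _ gS' LUV) (perm_big _ LUV) /= !psum_cat /= big_cat /=.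
have -> : \big[addb/false]_(y <- U) \big[addb/false]_(z <- x :: V) g y z =
    \big[addb/false]_(y <- U) g y x (+)
    \big[addb/false]_(y <- U) \big[addb/false]_(z <- V) g y z.
  by rewrite -big_split /=; apply: eq_bigr => y _; rewrite big_cons.
have -> : \big[addb/false]_(y <- U) g y x = \big[addb/false]_(y <- U) g x y.
  apply: eq_big_seq => y yU; apply: gS; rewrite ?mem_head // inE.
  by rewrite (perm_mem LUV) mem_cat yU orbT.
move: (\big[addb/false]_(y <- U) g x y) (\big[addb/false]_(y <- V) g x y).
by move: (psum g U) (psum g V) (bigop _ _ _) => [] [] [] [] [].
Qed.

Lemma psum_const g (c : bool) L : pairwise (fun x y => g x y == c) L ->
  psum g L = odd 'C(size L, 2) && c.
Proof.
elim: L => [|x L IH] //= /andP[/allP xL /IH ->].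
rewrite (eq_big_seq (fun=> c)); last by move=> y /xL/eqP.
by rewrite big_addb_const binS bin1 oddD andb_addl addbC.
Qed.

End PairSum.

Lemma psum_map (E E' : eqType) (f : E -> E') (g : E' -> E' -> bool) (L : seq E) :
  psum g (map f L) = psum (fun x y => g (f x) (f y)) L.
Proof. by elim: L => //= x L ->; rewrite big_map. Qed.

(** * Comparison of partial digit strings *)

(* om A B ps is the parity, for k odd, of the number of pairs (x, y) of
   completions of the partial digit strings A and B such that x comes before y in
   the lexicographic order along ps. *)
Section DigitOrder.
Variable k : nat.
Implicit Types (A B : nat -> option nat) (ps : seq nat).

Fixpoint om A B ps : bool :=
  if ps is p :: ps' then
    match A p, B p with
    | Some u, Some v => if u == v then om A B ps' else u < v
    | Some u, None => odd u (+) om A B ps'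
    | None, Some v => odd v (+) om A B ps'
    | None, None => odd 'C(k, 2) (+) om A B ps'
    end
  else false.

Definition upd A q i p := if p == q then Some i else A p.

Definition conflict_at A B p :=
  if (A p, B p) is (Some u, Some v) then u != v else false.

Lemma om_eq A A' B B' ps : {in ps, A =1 A'} -> {in ps, B =1 B'} ->
  om A B ps = om A' B' ps.
Proof.
elim: ps => //= p ps IH AA BB; rewrite (AA _ (mem_head _ _)) (BB _ (mem_head _ _)) IH //.
  by move=> q qp; apply: AA; rewrite inE qp orbT.
by move=> q qp; apply: BB; rewrite inE qp orbT.
Qed.

(** The comparison is decided at the first conflict, so later positions do not enter. *)
Lemma om_cat A B ps qs : has (conflict_at A B) ps -> om A B (ps ++ qs) = om A B ps.
Proof.
elim: ps => //= p ps IH; rewrite {1}/conflict_at.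
case: (A p) (B p) => [u|] [v|] /=; try by move=> /IH ->.
by case: eqVneq => //= _; exact: IH.
Qed.

(** Before the first conflict the contributions to both orders are equal and cancel; at it exactly
    one of u < v and v < u holds. *)
Lemma om_antisym A B ps : om A B ps (+) om B A ps = has (conflict_at A B) ps.
Proof.
elim: ps => //= p ps <-; rewrite {1}/conflict_at.
case: (A p) (B p) => [u|] [v|] /=; rewrite ?(addbACA _ _ (odd _)) ?addbb //.
by rewrite (eq_sym v); case: ltngtP.
Qed.

(** At [q] the k values of i add up to what a free digit contributes: against a digit v there are v
    smaller values and one equal value, against a free digit the values sum to C(k, 2). Elsewhere a
    term repeated k times equals itself modulo 2, as k is odd. *)
Lemma om_fill A B q ps : odd k -> uniq ps -> A q = None ->
  (forall v, B q = Some v -> v < k) ->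
  \big[addb/false]_(i < k) om (upd A q i) B ps = om A B ps.
Proof.
move=> kodd + Aq Bq; elim: ps => [|p ps IH] /= => [_|/andP[pps ups]].
  by rewrite big1_eq.
have [pq|pq] := eqVneq p q.
  have rest i : om (upd A q i) B ps = om A B ps.
    apply: om_eq => // x xps; rewrite /upd; case: eqP => // xq.
    by rewrite xq -pq (negPf pps) in xps.
  rewrite {1}/upd pq eqxx Aq; case E : (B q) => [v|].
    have vk := Bq v E; transitivity (\big[addb/false]_(i < k)
      (((i == Ordinal vk) && om A B ps) (+) odd (i < v))).
      apply: eq_bigr => i _; rewrite rest -val_eqE /=.
      by case: eqVneq => [->|_]; rewrite ?ltnn ?addbF // oddb.
    rewrite big_split /= big_addb_odd (bigD1 (Ordinal vk)) //= eqxx big1 ?addbF.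
      rewrite addbC; congr (odd _ (+) _).
      rewrite (eq_bigr (fun i : 'I_k => if i < v then 1 else 0)); last
        by move=> i _; case: ltnP.
      rewrite -big_mkcond /= (big_ord_narrow (ltnW vk)) /= sum_nat_const card_ord.
      by rewrite muln1.
    by move=> i /negPf ->.
  rewrite (eq_bigr (fun i : 'I_k => odd i (+) om A B ps)); last by move=> i _; rewrite rest.
  rewrite big_split /= big_addb_odd big_addb_const_ord kodd /=.
  by rewrite -bin2_sum big_mkord.
have cst (b : bool) : \big[addb/false]_(i < k) b = b.
  by rewrite big_addb_const_ord kodd.
rewrite -(IH ups).
have pE i : upd A q i p = A p by rewrite /upd (negPf pq).
rewrite (eq_bigr (fun i : 'I_k => match A p, B p with
    | Some u, Some v => if u == v then om (upd A q i) B ps else u < v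
    | Some u, None => odd u (+) om (upd A q i) B ps
    | None, Some v => odd v (+) om (upd A q i) B ps
    | None, None => odd 'C(k, 2) (+) om (upd A q i) B ps
    end)); last by move=> i _; rewrite pE.
case: (A p) (B p) => [u|] [v|]; rewrite ?big_split /= ?cst //.
by case: (u == v).
Qed.

(** Before [q] the strings agree: equal digits contribute nothing and each common free position
    contributes C(k, 2). Position [q] then decides. *)
Lemma om_siblings A q i j ps qs : A q = None -> q \notin ps -> i != j ->
  om (upd A q i) (upd A q j) (ps ++ q :: qs) =
  (i < j) (+) odd ('C(k, 2) * count (fun p => A p == None) ps).
Proof.
move=> Aq qps ij; elim: ps qps => [|p ps IH] /= qps.
  by rewrite /upd eqxx (negPf ij) muln0 addbF.
move: qps; rewrite inE negb_or => /andP[qp /IH {}IH].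
rewrite /upd (eq_sym p) (negPf qp) -!/(upd _ _ _) IH; case: (A p) => [u|] /=; rewrite ?eqxx //.
by rewrite mulnDr muln1 oddD addbCA.
Qed.

End DigitOrder.

(** * The order parity of two bricks and its behaviour under splits *)

Section BrickOrder.
Variables n k r : nat.
Hypotheses (n0 : 0 < n) (k2 : 2 <= k).
Local Notation brick := (brick n k r).
Implicit Types (b c : brick) (P Q : seq brick) (d e : 'I_n).

Definition digit (w : seq 'I_k) l : option nat := nth None [seq Some (val a) | a <- w] l.

Lemma digit_none w l : size w <= l -> digit w l = None.
Proof. by move=> wl; rewrite /digit nth_default ?size_map. Qed.

Lemma digit_some w l x0 : l < size w -> digit w l = Some (val (nth x0 w l)).
Proof. by move=> wl; rewrite /digit (nth_map x0). Qed.

(* Position 0 holds the component; position (l * n + d).+1 holds the digit of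
   index l in direction d. *)
Definition digits b p : option nat :=
  if p is p'.+1 then digit (b.2 (Ordinal (ltn_pmod p' n0))) (p' %/ n) else Some (val b.1).

Definition pos d l := (l * n + d).+1.

Lemma digits_pos b d l : digits b (pos d l) = digit (b.2 d) l.
Proof.
rewrite /digits /pos divnMDl // divn_small // addn0; congr (digit (b.2 _) _).
by apply: val_inj; rewrite /= modnMDl modn_small.
Qed.

Lemma digits_ext b d i : digits (ext b d i) =1 upd (digits b) (pos d (size (b.2 d))) i.
Proof.
case=> [|p]; first by [].
rewrite /upd /pos eqSS /=; set e := Ordinal _.
have pE : p = p %/ n * n + e by rewrite -divn_eq.
have -> : (p == size (b.2 d) * n + d) = (e == d) && (p %/ n == size (b.2 d)).
  apply/eqP/andP => [E|[/eqP <- /eqP <-]] //.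
  split; last by rewrite E divnMDl // divn_small // addn0.
  by rewrite -val_eqE /= E modnMDl modn_small.
rewrite /digit map_cat nth_cat size_map.
have [->|_] /= := eqVneq e d; last first.
  by rewrite nth_nil; case: ltnP => // s; rewrite nth_default ?size_map.
case: ltngtP => [//|s|->]; last by rewrite subnn.
by rewrite !nth_default ?size_map //=; lia.
Qed.

Definition reach b c := ((\sum_d (size (b.2 d) + size (c.2 d))) * n).+1.

(* The bound reach b c is large enough for disjoint bricks to differ at some
   position below it (disjoint_conflict); later positions are then irrelevant. *)
Definition omega b c := om k (digits b) (digits c) (iota 0 (reach b c)).

Lemma pos_reach b c d l : l < size (b.2 d) \/ l < size (c.2 d) -> pos d l < reach b c.
Proof.
move=> H; rewrite /pos /reach ltnS; have dn := ltn_ord d.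
have : l.+1 <= \sum_d (size (b.2 d) + size (c.2 d)).
  by rewrite (bigD1 d) //=; case: H; lia.
by rewrite -(leq_pmul2r n0) mulSn; lia.
Qed.

Definition disjoint_bricks b c := forall p, ~~ (inb p b && inb p c).

(** Without a conflict, in every direction one of the two words is a prefix of the other, and the
    brick with the longer words lies in both [b] and [c]. *)
Lemma disjoint_conflict b c : disjoint_bricks b c ->
  has (conflict_at (digits b) (digits c)) (iota 0 (reach b c)).
Proof.
move=> dis; apply/negPn/negP => /hasPn nc.
have bc1 : b.1 = c.1.
  have := nc 0; rewrite mem_iota /= => /(_ isT); rewrite /conflict_at /=.
  by rewrite negbK => /eqP/val_inj.
pose x0 : 'I_k := Ordinal (ltnW k2).
pose w d := if size (b.2 d) <= size (c.2 d) then c.2 d else b.2 d.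
pose p := brick_point ((b.1, w) : brick) (fun _ _ => x0).
have agree d l : l < size (b.2 d) -> l < size (c.2 d) ->
    nth x0 (b.2 d) l = nth x0 (c.2 d) l.
  move=> lb lc; have := nc (pos d l); rewrite mem_iota /= add0n pos_reach ?lb; last by left.
  move=> /(_ isT); rewrite /conflict_at !digits_pos !(digit_some x0) // negbK.
  by move=> /eqP/val_inj.
have := dis p; rewrite /inb /p /= bc1 eqxx /= => /negP; apply.
have wE d : mkseq (prepend (w d) (fun=> x0)) (size (b.2 d)) = b.2 d /\
            mkseq (prepend (w d) (fun=> x0)) (size (c.2 d)) = c.2 d.
  have wl : size (b.2 d) <= size (w d) /\ size (c.2 d) <= size (w d).
    by rewrite /w; case: (leqP (size (b.2 d)) (size (c.2 d))) => [|/ltnW] ?; split.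
  rewrite !mkseq_prepend_take ?wl; try by case: wl.
  split; apply: (@eq_from_nth _ x0); rewrite size_takel; try by case: wl.
    move=> i ib; rewrite nth_take // /w; case: leqP => // bc.
    by rewrite agree // (leq_trans ib).
  move=> i ic; rewrite nth_take // /w; case: leqP => // bc.
  by rewrite agree // (ltn_trans ic).
by apply/andP; split; apply/forallP => d; have [? ?] := wE d; apply/eqP.
Qed.

Lemma omega_iota b c M : disjoint_bricks b c -> reach b c <= M ->
  omega b c = om k (digits b) (digits c) (iota 0 M).
Proof.
move=> /disjoint_conflict dis RM; rewrite -(subnKC RM) iotaD om_cat //.
Qed.

Lemma omega_antisym b c : disjoint_bricks b c -> omega b c (+) omega c b.
Proof.
move=> dis; have dis' : disjoint_bricks c b by move=> p; rewrite andbC.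
have -> : omega c b = om k (digits c) (digits b) (iota 0 (reach b c)).
  rewrite /omega /reach; congr (om _ _ _ (iota _ (_ * _).+1)).
  by apply: eq_bigr => d _; rewrite addnC.
by rewrite om_antisym disjoint_conflict.
Qed.

Lemma omega_spl b c d : odd k -> disjoint_bricks b c ->
  \big[addb/false]_(x <- spl d b) omega x c = omega b c.
Proof.
move=> kodd dis; rewrite big_map big_enum /=.
(* A common bound for all pairs involved, so that [om_fill] applies along a single list of
   positions. *)
pose M := reach b c + \sum_(i < k) reach (ext b d i) c.
have dis' i : disjoint_bricks (ext b d i) c.
  by move=> p; rewrite inb_ext; apply: contra (dis p) => /andP[/andP[-> _]].
rewrite (@omega_iota b c M) ?leq_addr // -(@om_fill k _ _ (pos d (size (b.2 d)))) ?iota_uniq //.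
- apply: eq_bigr => i _; rewrite (@omega_iota _ _ M) //.
    by apply: om_eq => // p _; rewrite digits_ext.
  by rewrite /M (bigD1 i) //= addnCA leq_addr.
- by rewrite digits_pos digit_none.
- move=> v; rewrite digits_pos; case: (leqP (size (c.2 d)) (size (b.2 d))) => bc.
    by rewrite digit_none.
  by rewrite (digit_some (Ordinal (ltnW k2))) // => -[<-].
Qed.

(** Each of these positions contributes C(k, 2) when two pieces of [spl d b] are compared. *)
Definition free_before b d :=
  count (fun p => digits b p == None) (iota 0 (pos d (size (b.2 d)))).

Lemma omega_siblings b d (i j : 'I_k) : i < j ->
  omega (ext b d i) (ext b d j) = ~~ odd ('C(k, 2) * free_before b d).
Proof.
move=> ij; rewrite /omega; set M := reach _ _.
have qM : pos d (size (b.2 d)) < M.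
  by apply: pos_reach; left; rewrite size_ext eqxx addn1.
have -> : iota 0 M = iota 0 (pos d (size (b.2 d))) ++ pos d (size (b.2 d)) ::
    iota (pos d (size (b.2 d))).+1 (M - (pos d (size (b.2 d))).+1).
  by rewrite -{1}(subnKC qM) addSnnS iotaD.
transitivity (om k (upd (digits b) (pos d (size (b.2 d))) i)
   (upd (digits b) (pos d (size (b.2 d))) j)
   (iota 0 (pos d (size (b.2 d))) ++ pos d (size (b.2 d)) ::
    iota (pos d (size (b.2 d))).+1 (M - (pos d (size (b.2 d))).+1))).
  by apply: om_eq => p _; rewrite digits_ext.
rewrite om_siblings ?ij ?mem_iota ?add0n ?ltnn //; last by rewrite neq_ltn ij.
by rewrite digits_pos digit_none.
Qed.

(** All C(k, 2) pairs of pieces have the same [omega], the parity of 1 + C(k, 2) f with f =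
    [free_before b d]; modulo 2 the square of C(k, 2) is C(k, 2). *)
Lemma psum_spl b d : psum omega (spl d b) = odd ('C(k, 2) * (free_before b d).+1).
Proof.
rewrite (@psum_const _ _ (~~ odd ('C(k, 2) * free_before b d))) ?size_spl.
  by rewrite mulnS oddD; rewrite !oddM; case: (odd 'C(k, 2)).
rewrite pairwise_map.
have : pairwise (fun i j : 'I_k => i < j) (enum 'I_k).
  rewrite -(pairwise_map val ltn) val_enum_ord.
  by rewrite -sorted_pairwise ?iota_ltn_sorted //; exact: ltn_trans.
by apply: sub_pairwise => i j ij /=; rewrite omega_siblings.
Qed.

End BrickOrder.

(** * Morphisms from the abelianization defined by weights on bricks *)

Section Character.
Local Open Scope ring_scope.
Variables n k r : nat.
Hypotheses (n0 : (0 < n)%N) (k2 : (2 <= k)%N) (r0 : (0 < r)%N).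
Local Notation space := (thompson_space n k r).
Local Notation brick := (brick n k r).
Local Notation T := (thompson n k r).
Local Notation Vab := (abelianization (thompson n k r)).
Implicit Types (b c : brick) (P Q U V W : seq brick) (L : seq (brick * brick)).

Variables (B : zmodType) (s : B) (F : brick -> B) (gam : 'I_n -> B).
Hypothesis s2 : s *+ 2 = 0.
Hypothesis s_even : ~~ odd k -> s = 0.
(** The second summand is the pair term of the pieces by [psum_spl], so that a split in direction
    [d] will change [Psi] by [gam d]. *)
Hypothesis F_ext : forall b d,
  \sum_(x <- spl d b) F x + s *+ ('C(k, 2) * (free_before n0 b d).+1) = F b + gam d.

Lemma s_odd m : s *+ m = s *+ odd m.
Proof. by rewrite -{1}(odd_double_half m) mulrnDr -mul2n mulrnA s2 mul0rn addr0. Qed.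

Lemma s_addb (a c : bool) : s *+ (a (+) c) = s *+ a + s *+ c.
Proof. by rewrite -mulrnDr [in RHS]s_odd oddD !oddb. Qed.

Lemma s_opp m : - (s *+ m) = s *+ m.
Proof. by apply/eqP; rewrite eq_sym -addr_eq0 -mulrnDr addnn -mul2n mulrnA s2 mul0rn. Qed.

Definition Psi P : B := \sum_(b <- P) F b + s *+ psum (omega n0) P.

Definition Phi L : B := Psi (unzip2 L) - Psi (unzip1 L).

Lemma PhiE L : Phi L = \sum_(x <- L) (F x.2 - F x.1) +
  s *+ psum (fun x y => omega n0 x.2 y.2 (+) omega n0 x.1 y.1) L.
Proof.
rewrite /Phi /Psi /unzip1 /unzip2 !psum_map psum_addb s_addb !big_map opprD s_opp.
by rewrite addrACA sumrB.
Qed.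

Lemma tiling_disjoint P b c : tiling P -> b \in P -> c \in P -> b != c ->
  disjoint_bricks b c.
Proof.
move=> tP bP cP bc p; apply: contra bc => /andP[pb pc].
by apply/eqP; apply: tiling_inj tP bP cP pb pc.
Qed.

Lemma uniq_unzip1 L x y : uniq (unzip1 L) -> x \in L -> y \in L -> x.1 = y.1 -> x = y.
Proof.
elim: L => //= a L IH /andP[aL uL]; rewrite !inE.
move=> /orP[/eqP->|xL] /orP[/eqP->|yL] // E; last exact: IH.
  by move: aL; rewrite E => /negP[]; apply: map_f.
by move: aL; rewrite -E => /negP[]; apply: map_f.
Qed.

Lemma uniq_unzip2 L x y : uniq (unzip2 L) -> x \in L -> y \in L -> x.2 = y.2 -> x = y.
Proof.
elim: L => //= a L IH /andP[aL uL]; rewrite !inE.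
move=> /orP[/eqP->|xL] /orP[/eqP->|yL] // E; last exact: IH.
  by move: aL; rewrite E => /negP[]; apply: map_f.
by move: aL; rewrite -E => /negP[]; apply: map_f.
Qed.

(** Reversing a pair of disjoint bricks flips [omega] in the domain and in the range alike, so the
    combined pair term in [PhiE] is symmetric. *)
Lemma Phi_perm L L' : tiling (unzip1 L) -> tiling (unzip2 L) -> perm_eq L L' ->
  Phi L = Phi L'.
Proof.
move=> t1 t2 LL'; rewrite !PhiE (perm_big _ LL') /=; congr (_ + _ *+ nat_of_bool _).
apply: psum_perm LL' => x y xL yL; have [->|xy] := eqVneq x y; first by [].
have d1 : disjoint_bricks x.1 y.1.
  apply: (tiling_disjoint t1 (map_f _ xL) (map_f _ yL)); apply: contra xy => /eqP E.
  by apply/eqP; apply: (uniq_unzip1 (tiling_uniq k2 t1) xL yL E).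
have d2 : disjoint_bricks x.2 y.2.
  apply: (tiling_disjoint t2 (map_f _ xL) (map_f _ yL)); apply: contra xy => /eqP E.
  by apply/eqP; apply: (uniq_unzip2 (tiling_uniq k2 t2) xL yL E).
have := omega_antisym n0 k2 d1; have := omega_antisym n0 k2 d2.
by do 4!case: omega.
Qed.

(** Pairs inside the split brick are accounted for by [F_ext]; pairs with another brick keep their
    sum by [omega_spl]. *)
Lemma Psi_spl d b V : tiling (b :: V) -> Psi (spl d b ++ V) = Psi (b :: V) + gam d.
Proof.
move=> tV; rewrite /Psi psum_cat big_cat big_cons /= !s_addb psum_spl //.
rewrite -s_odd.
have -> : s *+ (\big[addb/false]_(x <- spl d b) \big[addb/false]_(y <- V) omega n0 x y) =
          s *+ (\big[addb/false]_(y <- V) omega n0 b y).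
  (* Additivity of [omega] is available for odd k; for even k the element [s] vanishes. *)
  case: (boolP (odd k)) => [kodd|/s_even ->]; last by rewrite !mul0rn.
  rewrite exchange_big /=; congr (_ *+ nat_of_bool _).
  apply: eq_big_seq => c cV; rewrite omega_spl //.
  apply: (tiling_disjoint tV); rewrite ?mem_head ?inE ?cV ?orbT //.
  by have := tiling_uniq k2 tV => /= /andP[bV _]; apply: contraNneq bV => ->.
rewrite -(addrA (s *+ ('C(k, 2) * _))) addrACA F_ext.
rewrite (addrC (s *+ psum _ _)) !addrA [RHS]addrAC; congr (_ + _).
by rewrite [RHS]addrAC; congr (_ + _); rewrite addrAC.
Qed.

Lemma Psi_split_head d P : tiling P -> (0 < size P)%N ->
  Psi (split_head d P) = Psi P + gam d.
Proof. by case: P => // b V tP _; apply: Psi_spl. Qed.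

Let ext2 (x : brick * brick) d i := (ext x.1 d i, ext x.2 d i).

Lemma gspl_unzip x d :
  unzip1 (gspl ext2 d x) = spl d x.1 /\ unzip2 (gspl ext2 d x) = spl d x.2.
Proof. by split; rewrite /unzip1 /unzip2 /gspl -map_comp. Qed.

Lemma splits_carries (h : space -> space) L D L' : splits ext2 L D L' ->
  {in L, forall x, carries h x.1 x.2} -> {in L', forall x, carries h x.1 x.2}.
Proof.
elim=> {L D L'} // U x V d D L _ IH hL; apply: IH => y.
rewrite !mem_cat => /or3P[yU|/mapP[i _ ->]|yV]; last 1 first.
- by apply: hL; rewrite mem_cat inE yV !orbT.
- by apply: hL; rewrite mem_cat yU.
- by apply: carries_extend; apply: hL; rewrite mem_cat mem_head orbT.
Qed.

(** The split pair is brought to the front, where domain and range both change by [gam d]. *)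
Lemma Phi_splits L D L' : splits ext2 L D L' -> tiling (unzip1 L) -> tiling (unzip2 L) ->
  [/\ tiling (unzip1 L'), tiling (unzip2 L') & Phi L' = Phi L].
Proof.
elim=> {L D L'} // U x V d D L _ IH t1 t2.
have [g1 g2] := gspl_unzip x d.
have t1'_ : tiling (unzip1 (U ++ gspl ext2 d x ++ V)).
  rewrite /unzip1 !map_cat -!/(unzip1 _) g1; apply/tiling_spl.
  by move: t1; rewrite /unzip1 map_cat.
have t2'_ : tiling (unzip2 (U ++ gspl ext2 d x ++ V)).
  rewrite /unzip2 !map_cat -!/(unzip2 _) g2; apply/tiling_spl.
  by move: t2; rewrite /unzip2 map_cat.
have [t1' t2' ->] := IH t1'_ t2'_; split=> //.
have p0 : perm_eq (U ++ x :: V) (x :: U ++ V) by apply/permPl/(perm_catCA U [:: x]).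
have p1 : perm_eq (U ++ gspl ext2 d x ++ V) (gspl ext2 d x ++ (U ++ V)).
  by apply/permPl/perm_catCA.
have u1 : tiling (x.1 :: unzip1 (U ++ V)).
  change (tiling (unzip1 (x :: U ++ V))).
  by apply: tiling_perm t1; apply: perm_map.
have u2 : tiling (x.2 :: unzip2 (U ++ V)).
  change (tiling (unzip2 (x :: U ++ V))).
  by apply: tiling_perm t2; apply: perm_map.
have v1 : tiling (unzip1 (gspl ext2 d x ++ (U ++ V))).
  by apply: (tiling_perm _ t1'_); apply: perm_map.
have v2 : tiling (unzip2 (gspl ext2 d x ++ (U ++ V))).
  by apply: (tiling_perm _ t2'_); apply: perm_map.
rewrite (Phi_perm t1 t2 p0) (Phi_perm t1'_ t2'_ p1) /Phi.
rewrite /unzip1 /unzip2 !(map_cat _ (gspl _ _ _)) -!/(unzip1 _) -!/(unzip2 _) g1 g2.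
by rewrite !Psi_spl // opprD addrACA subrr addr0.
Qed.

(** By [carries_inj] the map [h] determines the second brick of a pair from the first. *)
Lemma uniq_perm_graph (h : space -> space) L L' :
  {in L, forall x, carries h x.1 x.2} -> {in L', forall x, carries h x.1 x.2} ->
  uniq (unzip1 L) -> perm_eq (unzip1 L) (unzip1 L') -> perm_eq L L'.
Proof.
have sub L1 L2 : {in L1, forall x, carries h x.1 x.2} ->
    {in L2, forall x, carries h x.1 x.2} -> perm_eq (unzip1 L1) (unzip1 L2) ->
    {subset L1 <= L2}.
  move=> h1 h2 p12 x xL1; have : x.1 \in unzip1 L2.
    by rewrite -(perm_mem p12); apply: map_f.
  case/mapP => y yL2 E; suff -> : x = y by [].
  have := h2 y yL2; rewrite -E => /(carries_inj k2 (h1 x xL1)) E2.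
  by case: x y E E2 {xL1 yL2} => [? ?] [? ?] /= -> ->.
move=> hL hL' uL LL'; apply: uniq_perm; first exact: map_uniq uL.
  by apply: (@map_uniq _ _ fst); rewrite -[map fst L']/(unzip1 L') -(perm_uniq LL').
by move=> x; apply/idP/idP; apply: sub; rewrite // perm_sym.
Qed.

Lemma carry_zip (h : space -> space) L :
  {in L, forall x, carries h x.1 x.2} <-> carry h (unzip1 L) (unzip2 L).
Proof.
rewrite /carry zip_unzip; split=> [H|[_ H]] //; split=> //.
by rewrite /unzip1 /unzip2 !size_map.
Qed.

(** Refining both lists until their domains have the same uniform depth makes them equal up to
    order. *)
Lemma Phi_uniq (h : homeo space) L L' : tiling (unzip1 L) -> tiling (unzip1 L') ->
  {in L, forall x, carries h x.1 x.2} -> {in L', forall x, carries h x.1 x.2} ->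
  Phi L = Phi L'.
Proof.
move=> t1 t1' hL hL'.
have t2 : tiling (unzip2 L) by apply/(carry_tiling ((carry_zip h L).1 hL)).
have t2' : tiling (unzip2 L') by apply/(carry_tiling ((carry_zip h L').1 hL')).
have [M LM] := exists_depth (unzip1 L ++ unzip1 L').
have [||D [N [sN fN]]] := @refine n k r _ ext2 fst M _ L.
- by [].
- by move=> x xL d; apply: LM; rewrite mem_cat map_f.
have [||D' [N' [sN' fN']]] := @refine n k r _ ext2 fst M _ L'.
- by [].
- by move=> x xL d; apply: LM; rewrite mem_cat (map_f fst xL) orbT.
have [u1 u2 <-] := Phi_splits sN t1 t2; have [u1' u2' <-] := Phi_splits sN' t1' t2'.
apply: Phi_perm => //.
apply: (uniq_perm_graph (splits_carries sN hL) (splits_carries sN' hL')).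
  exact: tiling_uniq u1.
by apply: (tiling_full_perm k2 u1 u1') => [_ /mapP[x xN ->]|_ /mapP[x xN ->]];
  [apply: fN|apply: fN'].
Qed.

(** Refining the range of [h] to a depth at which [g] acts canonically prepares the composition in
    [characterM]. *)
Lemma thompson_zip (h : T) (g : T) : exists L, [/\ tiling (unzip1 L), tiling (unzip2 L),
  carry h (unzip1 L) (unzip2 L) & exists R, carry g (unzip2 L) R].
Proof.
have [N hN] := thompson_carry k2 h; have [N' gN'] := thompson_carry k2 g.
have [P tP fP] := @tiling_full n k r N.
have [Q hPQ] := hN N (leqnn _) P tP fP.
have sPQ : size P = size Q by case: hPQ.
have [M QM] := exists_depth Q.
have hL : {in zip P Q, forall x, carries h x.1 x.2} by case: hPQ.
have [||D [L [sL fL]]] := @refine n k r _ ext2 snd (maxn M N') _ (zip P Q).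
- by [].
- move=> x xL d; rewrite leq_max QM // -(@unzip2_zip _ _ P Q) ?sPQ //.
  exact: map_f.
have tQ := (carry_tiling hPQ).1 tP.
have [||t1 t2 _] := Phi_splits sL; rewrite ?unzip1_zip ?unzip2_zip ?sPQ //.
exists L; split=> //; first by apply/carry_zip; apply: splits_carries sL hL.
apply: gN' t2 _; first exact: leq_maxr.
by move=> _ /mapP[x xL ->]; apply: fL.
Qed.

Definition character (h : T) : B :=
  xget 0 [set v | exists L,
    [/\ tiling (unzip1 L), carry h (unzip1 L) (unzip2 L) & v = Phi L]]%classic.

Lemma characterE (h : T) P Q : tiling P -> carry h P Q -> character h = Psi Q - Psi P.
Proof.
move=> tP hPQ; have sPQ : size P = size Q by case: hPQ.
have PhiPQ : Psi Q - Psi P = Phi (zip P Q) by rewrite /Phi unzip1_zip ?unzip2_zip ?sPQ.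
rewrite PhiPQ /character; case: xgetP.
  move=> v _ [L [tL /carry_zip hL ->]]; apply: (@Phi_uniq h) => //.
    by rewrite unzip1_zip ?sPQ.
  by case: hPQ.
move=> /(_ (Phi (zip P Q)))[].
by exists (zip P Q); rewrite unzip1_zip ?unzip2_zip ?sPQ.
Qed.

Lemma characterM (g h : T) : character (g * h)%g = character g + character h.
Proof.
have [L [t1 t2 hL [R gR]]] := thompson_zip h g.
have ghR : carry (g * h)%g (unzip1 L) R by exact: carryM hL gR.
rewrite (characterE t1 ghR) (characterE t1 hL) (characterE t2 gR).
by rewrite addrA subrK.
Qed.

Lemma character1 : character 1%g = 0.
Proof. by apply: (addIr (character 1%g)); rewrite -characterM mul1g add0r. Qed.

Lemma characterV (h : T) : character (h^-1)%g = - character h.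
Proof. by apply: (addIr (character h)); rewrite -characterM mulVg character1 addNr. Qed.

Lemma character_derived (h : T) : derived h -> character h = 0.
Proof.
elim=> [|x y|x y _ hx _ hy|x _ hx]; first exact: character1.
- by rewrite /commg /conjg !characterM !characterV addrA -opprD addNr.
- by rewrite characterM hx hy addr0.
- by rewrite characterV hx oppr0.
Qed.

(** The choice of representative is harmless because [character] vanishes on derived elements. *)
Definition ab_character (a : Vab) : B := character (repr a).

Lemma ab_characterE (h : T) : ab_character (ab h) = character h.
Proof.
have /character_derived := ab_piK h; rewrite characterM characterV.
by move/eqP; rewrite addrC subr_eq0 => /eqP.
Qed.

Lemma ab_characterD : {morph ab_character : x y / x + y}.
Proof.
move=> x y; have [h <-] := ab_surj x; have [g <-] := ab_surj y.
by rewrite -abM !ab_characterE characterM.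
Qed.

Lemma ab_character_exch P v Q : exch P v Q -> ab_character v = Psi Q - Psi P.
Proof. by case=> tP _ _ _ [h hPQ <-]; rewrite ab_characterE; apply: characterE. Qed.

(** Only the term of the transposed pair changes, and [omega] differs on the two orders of that
    pair. *)
Lemma ab_character_transp : ab_character (transp_class n k r) = s.
Proof.
have [[|a [|b V]] // tP sP] := large_tiling n0 k2 r0.
rewrite (ab_character_exch (exch_swap n0 k2 r0 (U := [::]) tP sP)) /=.
have dab : disjoint_bricks a b.
  apply: (tiling_disjoint tP); rewrite ?inE ?eqxx ?orbT //.
  by have /= := tiling_uniq k2 tP; rewrite inE negb_or => /andP[/andP[]].
have := omega_antisym n0 k2 dab; rewrite /Psi /= !big_cons !s_addb => w1.
have sE : s = s *+ omega n0 b a - s *+ omega n0 a b.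
  by rewrite s_opp -s_addb addbC w1.
rewrite opprD addrACA (addrCA (F b)) subrr add0r [RHS]sE.
set u := s *+ omega n0 b a; set v := s *+ omega n0 a b.
set x := s *+ nat_of_bool (bigop _ _ _); set y := s *+ nat_of_bool (bigop _ _ _).
set z := s *+ nat_of_bool (psum _ _).
by rewrite -(addrA u) -(addrA v) (addrCA y) opprD addrACA subrr addr0.
Qed.

Lemma ab_character_baker d : ab_character (baker_class k r n0 d) = gam d - gam (Ordinal n0).
Proof.
have [P tP sP] := large_tiling n0 k2 r0.
rewrite (ab_character_exch (exch_baker n0 k2 r0 d tP sP)).
have P0 : (0 < size P)%N by apply: leq_trans sP.
rewrite !Psi_split_head //.
by rewrite opprD addrACA subrr add0r.
Qed.

End Character.

(** * Isomorphism criteria and cyclic groups *)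

Section Isomorphisms.
Local Open Scope ring_scope.

Lemma zmod_isomorphicP (A B : zmodType) (f : A -> B) : {morph f : x y / x + y} ->
  (forall x, f x = 0 -> x = 0) -> (forall y, exists x, f x = y) -> zmod_isomorphic A B.
Proof.
move=> fD f0 fsurj.
have f00 : f 0 = 0 by apply: (addIr (f 0)); rewrite -fD !add0r.
have fB : zmod_morphism f.
  by move=> x y; apply: (addIr (f y)); rewrite -fD !subrK.
pose F : {additive A -> B} := HB.pack f (GRing.isZmodMorphism.Build A B f fB).
exists F; have [g gK] := choice fsurj.
exists g => x; last exact: gK.
by apply/eqP; rewrite -subr_eq0; apply/eqP/f0; rewrite fB gK subrr.
Qed.

Lemma zmod_isomorphic_trans (A B C : zmodType) :
  zmod_isomorphic A B -> zmod_isomorphic B C -> zmod_isomorphic A C.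
Proof.
move=> [f [f' fK f'K]] [g [g' gK g'K]]; apply: (@zmod_isomorphicP _ _ (g \o f)).
- by move=> x y /=; rewrite !raddfD.
- by move=> x /=; rewrite -(raddf0 g) => /(can_inj gK); rewrite -(raddf0 f) => /(can_inj fK).
- by move=> y; exists (f' (g' y)); rewrite /= f'K g'K.
Qed.

Definition cyc m : cyclicZ m := inZp 1.

Lemma cyc_mulrn m N : cyc m *+ N = (inZp N : cyclicZ m).
Proof.
elim: N => [|N IH]; first by apply: val_inj; rewrite mulr0n /= mod0n.
by rewrite mulrS IH; apply: val_inj; rewrite /= modnDm add1n.
Qed.

Lemma cyc_mulrn_eq0 m N : (0 < m)%N -> (cyc m *+ N == 0) = (m %| N)%N.
Proof. by case: m => // m _; rewrite cyc_mulrn -val_eqE. Qed.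

Lemma cyc_mulrn0 m N : (0 < m)%N -> (m %| N)%N -> cyc m *+ N = 0.
Proof. by move=> m0 mN; apply/eqP; rewrite cyc_mulrn_eq0. Qed.

Lemma cyc_surj m (y : cyclicZ m) : exists N, cyc m *+ N = y.
Proof. by exists (val (y : 'I_m.-1.+1)); rewrite cyc_mulrn; apply: valZpK. Qed.

Lemma cyc_mod m N N' : (0 < m)%N -> N = N' %[mod m] -> cyc m *+ N = cyc m *+ N'.
Proof. by case: m => // m _ E; rewrite !cyc_mulrn; apply: val_inj. Qed.

End Isomorphisms.

(** * Normal forms, and the cases with linear weights *)

Section Cases.
Local Open Scope ring_scope.
Variables n k r : nat.
Hypotheses (n0 : (0 < n)%N) (k2 : (2 <= k)%N) (r0 : (0 < r)%N).
Local Notation brick := (brick n k r).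
Local Notation Vab := (abelianization (thompson n k r)).
Local Notation d0 := (Ordinal n0).
Local Notation sw := (transp_class n k r).
Local Notation baker := (baker_class k r n0).

Lemma sw2 : sw *+ 2 = 0. Proof. exact: transp_class2. Qed.

Lemma sw_odd m : sw *+ m = sw *+ odd m. Proof. exact: transp_odd. Qed.

Lemma baker_order d : d != d0 -> baker d *+ k.-1 = sw *+ 'C(k, 2).
Proof.
by move=> dd; rewrite (baker_class_relation n0 k2 r0 dd) baker_class0 // mul0rn add0r.
Qed.

Lemma baker_order2 d : baker d *+ (k.-1 * 2) = 0.
Proof.
have [->|dd] := eqVneq d d0; first by rewrite baker_class0 // mul0rn.
by rewrite mulrnA baker_order // -mulrnA mulnC mulrnA sw2 mul0rn.
Qed.

Lemma ab_normal_form (x : Vab) : exists (N : 'I_n -> nat) (m : nat),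
  x = \sum_d baker d *+ N d + sw *+ m.
Proof.
have [D [D' [m [_ ->]]]] := ab_generated n0 k2 r0 x.
have cE (l : seq 'I_n) : \sum_(d <- l) baker d = \sum_d baker d *+ count_mem d l.
  elim: l => [|e l IH]; first by rewrite big_nil big1.
  rewrite big_cons IH (bigD1 e) //= [RHS](bigD1 e) //= eqxx mulrS -!addrA; congr (_ + (_ + _)).
  by apply: eq_bigr => d /negPf de; rewrite eq_sym de.
(* Negative multiples are avoided: 2 (k - 1) - 1 acts as -1 on [baker d]. *)
exists (fun d => count_mem d D + (k.-1 * 2).-1 * count_mem d D')%N, m.
congr (_ + _); rewrite !cE -sumrB; apply: eq_bigr => d _.
rewrite mulrnDr mulrnA; congr (_ + _); rewrite -mulNrn; congr (_ *+ _).
apply/eqP; rewrite eq_sym -addr_eq0 -mulrSr prednK ?baker_order2 //.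
by rewrite muln_gt0 andbT; lia.
Qed.

Lemma ab_character_normal (B : zmodType) (s : B) (F : brick -> B) (gam : 'I_n -> B) :
  s *+ 2 = 0 -> (~~ odd k -> s = 0) ->
  (forall b d, \sum_(x <- spl d b) F x + s *+ ('C(k, 2) * (free_before n0 b d).+1) =
     F b + gam d) ->
  exists2 f : Vab -> B, {morph f : x y / x + y} &
    forall (N : 'I_n -> nat) m, f (\sum_d baker d *+ N d + sw *+ m) =
      \sum_d (gam d - gam d0) *+ N d + s *+ m.
Proof.
move=> s2 s_even F_ext; exists (ab_character n0 s F).
  exact: (ab_characterD k2 s2 s_even F_ext).
move=> N m; set f := ab_character n0 s F.
have fD : {morph f : x y / x + y} by exact: (ab_characterD k2 s2 s_even F_ext).
have f0 : f 0 = 0 by apply: (addIr (f 0)); rewrite -fD !add0r.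
have fMn x i : f (x *+ i) = f x *+ i.
  by elim: i => [|i IH]; rewrite ?mulr0n ?f0 // !mulrS fD IH.
have fsw : f sw = s := ab_character_transp k2 r0 s2 s_even F_ext.
rewrite fD (big_morph f fD f0) fMn fsw; congr (_ + _); apply: eq_bigr => d _.
by rewrite fMn /f (ab_character_baker k2 r0 s2 s_even F_ext).
Qed.

Section Untwisted.
Variables (B : zmodType) (s : B) (c : 'I_n -> B).
Hypothesis s2 : s *+ 2 = 0.
Hypothesis s_even : ~~ odd k -> s = 0.
Hypothesis sC : s *+ 'C(k, 2) = 0.
Hypothesis c0 : c d0 = 0.
Hypothesis ck : forall d, c d *+ k.-1 = 0.

Definition weight (b : brick) : B := \sum_d c d *+ size (b.2 d).

(** Each of the k pieces has weight [weight b + c d], and multiplication by k fixes this sum since k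
    - 1 kills every [c e]. *)
Lemma weight_ext b d :
  \sum_(x <- spl d b) weight x + s *+ ('C(k, 2) * (free_before n0 b d).+1) =
  weight b + c d.
Proof.
have kE (y : B) : y *+ k.-1 = 0 -> y *+ k = y.
  by move=> y0; rewrite -[in LHS](ltn_predK k2) mulrS y0 addr0.
rewrite mulrnA sC mul0rn addr0 big_map (eq_bigr (fun=> weight b + c d)) => [|i _].
  rewrite big_const_seq count_predT size_enum_ord iter_addr_0 kE //.
  rewrite mulrnDl ck addr0 /weight -sumrMnl big1 // => e _.
  by rewrite -mulrnA mulnC mulrnA ck mul0rn.
rewrite /weight (eq_bigr (fun e => c e *+ size (b.2 e) + c e *+ (e == d))); last first.
  by move=> e _; rewrite size_ext mulrnDr.
rewrite big_split /=; congr (_ + _); rewrite (bigD1 d) //= eqxx big1 ?addr0 //.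
by move=> e /negPf ->.
Qed.

(** The first two hypotheses give surjectivity, and injectivity on normal forms: a combination
    vanishing in [B] must vanish already by the relations among the generators of [Vab]. *)
Lemma untwisted_iso :
  (forall y, exists (N : 'I_n -> nat) (m : nat), \sum_d c d *+ N d + s *+ m = y) ->
  (forall (N : 'I_n -> nat) (m : nat), \sum_d c d *+ N d + s *+ m = 0 ->
     (forall d, d != d0 -> (k.-1 %| N d)%N) /\ (sw != 0 -> ~~ odd m)) ->
  sw *+ 'C(k, 2) = 0 ->
  zmod_isomorphic Vab B.
Proof.
move=> c_surj c_inj swC.
have [f fD fE'] := ab_character_normal s2 s_even weight_ext.
have fE (N : 'I_n -> nat) m : f (\sum_d baker d *+ N d + sw *+ m) = \sum_d c d *+ N d + s *+ m.
  by rewrite fE'; congr (_ + _); apply: eq_bigr => d _; rewrite c0 subr0.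
apply: (zmod_isomorphicP fD) => [x|y]; last first.
  by have [N [m <-]] := c_surj y; rewrite -fE; eexists.
have [N [m ->]] := ab_normal_form x; rewrite fE => /c_inj[kN m_even].
rewrite sw_odd; have -> : sw *+ odd m = 0.
  by have [->|/m_even/negPf ->] := eqVneq sw 0; rewrite ?mul0rn.
rewrite addr0 big1 // => d _; have [->|dd] := eqVneq d d0.
  by rewrite baker_class0 // mul0rn.
by have /dvdnP[j ->] := kN d dd; rewrite mulnC mulrnA baker_order // swC mul0rn.
Qed.

End Untwisted.

Lemma dir_subproof (i : 'I_(n - 1)) : (i.+1 < n)%N.
Proof. by have := ltn_ord i; lia. Qed.

Let dir (i : 'I_(n - 1)) : 'I_n := Ordinal (dir_subproof i).

Lemma dir_surj d : d != d0 -> exists i, d = dir i.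
Proof.
rewrite -val_eqE /= => d_gt0; have dn : (d.-1 < n - 1)%N by have := ltn_ord d; lia.
by exists (Ordinal dn); apply: val_inj => /=; lia.
Qed.

(** The standard basis vector of direction [d]; it is zero for [d0], whose baker class is
    trivial. *)
Let unit_vec (d : 'I_n) : {ffun 'I_(n - 1) -> cyclicZ (k - 1)} :=
  [ffun i => cyc (k - 1) *+ (d == dir i)].

Lemma unit_vec_order d : unit_vec d *+ k.-1 = 0.
Proof.
apply/ffunP => i; rewrite ffunMnE !ffunE -mulrnA mulnC mulrnA.
by rewrite cyc_mulrn0 ?mul0rn ?subn1 // -subn1 subn_gt0.
Qed.

Lemma unit_vec_sum (N : 'I_n -> nat) i :
  (\sum_d unit_vec d *+ N d) i = cyc (k - 1) *+ N (dir i).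
Proof.
rewrite sum_ffunE (bigD1 (dir i)) //= big1 ?addr0 => [|d /negPf di].
  by rewrite ffunMnE !ffunE eqxx.
by rewrite ffunMnE !ffunE di mulr0n mul0rn.
Qed.

Lemma unit_vec_surj y : exists N : 'I_n -> nat, \sum_d unit_vec d *+ N d = y.
Proof.
have [M My] := choice (fun i => cyc_surj (y i)).
exists (fun d => \sum_(i | d == dir i) M i)%N; apply/ffunP => i.
rewrite unit_vec_sum -My; congr (_ *+ _); apply: big_pred1 => j /=.
by rewrite -!val_eqE /= eqSS eq_sym.
Qed.

Lemma unit_vec_inj (N : 'I_n -> nat) : \sum_d unit_vec d *+ N d = 0 ->
  forall d, d != d0 -> (k.-1 %| N d)%N.
Proof.
move=> E d /dir_surj[i ->]; have := congr1 (fun y : {ffun _ -> _} => y i) E.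
rewrite /= unit_vec_sum ffunE => /eqP; rewrite cyc_mulrn_eq0 ?subn1 //.
by rewrite -subn1 subn_gt0.
Qed.

Lemma ab_iso_ffun : sw = 0 ->
  zmod_isomorphic Vab {ffun 'I_(n - 1) -> cyclicZ (k - 1)}.
Proof.
move=> sw0; apply: (@untwisted_iso _ 0 unit_vec); rewrite ?mul0rn //.
- exact: unit_vec_order.
- by move=> y; have [N <-] := unit_vec_surj y; exists N, 0%N; rewrite mulr0n addr0.
- move=> N m; rewrite mul0rn addr0 => /unit_vec_inj kN; split=> //.
  by rewrite sw0 eqxx.
- by rewrite sw0 mul0rn.
Qed.

(** For even C(k, 2) the sign term in the weight condition vanishes, so [s] can generate a separate
    factor of order 2. *)
Lemma ab_iso_ffun_prod : odd k -> ~~ odd 'C(k, 2) ->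
  zmod_isomorphic Vab ({ffun 'I_(n - 1) -> cyclicZ (k - 1)} * cyclicZ 2)%type.
Proof.
move=> kodd Ceven; pose s : {ffun 'I_(n - 1) -> cyclicZ (k - 1)} * cyclicZ 2 := (0, cyc 2).
pose c d : {ffun 'I_(n - 1) -> cyclicZ (k - 1)} * cyclicZ 2 := (unit_vec d, 0).
have sum_pair (N : 'I_n -> nat) m : \sum_d c d *+ N d + s *+ m =
    (\sum_d unit_vec d *+ N d, cyc 2 *+ m).
  rewrite [LHS]surjective_pairing !raddfD !raddf_sum !raddfMn /= mul0rn addr0.
  by congr pair; [apply: eq_bigr => d _; rewrite raddfMn|
    rewrite big1 ?add0r // => d _; rewrite raddfMn mul0rn].
have s2 : s *+ 2 = 0.
  by apply: injective_projections; rewrite raddfMn /s /= ?mul0rn //; exact: (@cyc_mulrn0 2 2).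
have even_mul (G : zmodType) (t : G) m : t *+ 2 = 0 -> ~~ odd m -> t *+ m = 0.
  by move=> t2 m_even; rewrite -(odd_double_half m) (negPf m_even) -mul2n mulrnA t2 mul0rn.
apply: (@untwisted_iso _ s c) => //.
- by rewrite kodd.
- exact: even_mul.
- move=> d; apply: injective_projections; rewrite raddfMn /= ?mul0rn //.
  exact: unit_vec_order.
- move=> [y z]; have [N <-] := unit_vec_surj y; have [m <-] := cyc_surj z.
  by exists N, m; apply: sum_pair.
- move=> N m; rewrite sum_pair => -[/unit_vec_inj kN /eqP].
  by rewrite cyc_mulrn_eq0 // dvdn2.
- by apply: even_mul; rewrite ?sw2.
Qed.

End Cases.

(** * Dimension one *)

Lemma digit_eq_none k (w : seq 'I_k) l : (digit w l == None) = (size w <= l)%N.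
Proof.
case: leqP => [/digit_none -> //|wl].
by case: w wl => // a w wl; rewrite (digit_some a wl).
Qed.

Section OneDimensional.
Local Open Scope ring_scope.
Variables k r : nat.
Hypotheses (k2 : (2 <= k)%N) (r0 : (0 < r)%N).

Lemma free_before_1 (b : brick 1 k r) d : free_before (ltn0Sn 0) b d = 0%N.
Proof.
apply/eqP; rewrite -leqn0 leqNgt -has_count; apply/hasPn => p.
rewrite mem_iota add0n /= => pb; case: p pb => // p.
rewrite /pos ord1 /= muln1 addn0 divn1 ltnS => pb.
by rewrite digit_eq_none -ltnNge (ord1 (Ordinal _)).
Qed.

Lemma ab_iso_1_odd : odd k -> zmod_isomorphic (abelianization (thompson 1 k r)) (cyclicZ 2).
Proof.
move=> kodd; pose s := cyc 2.
have s2 : s *+ 2 = 0 by apply/eqP; rewrite cyc_mulrn_eq0.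
(* No free position precedes a split, so the zero weight works with the constant change C(k, 2)
   s. *)
have [|b d|f fD fE] := ab_character_normal (n0 := ltn0Sn 0) k2 r0 (F := fun=> 0)
    (gam := fun=> s *+ 'C(k, 2)) s2.
- by rewrite kodd.
- by rewrite free_before_1 muln1 big1.
have fsw m : f (transp_class 1 k r *+ m) = s *+ m.
  have := fE (fun=> 0%N) m; rewrite !big1 ?add0r // => d _; exact: mulr0n.
apply: (zmod_isomorphicP fD) => [x|y]; last first.
  by have [m <-] := cyc_surj y; rewrite -fsw; eexists.
have [N [m ->]] := ab_normal_form (ltn0Sn 0) k2 r0 x.
rewrite big1 ?add0r => [|d _].
  rewrite fsw => /eqP; rewrite cyc_mulrn_eq0 // dvdn2 => m_even.
  by rewrite sw_odd // (negPf m_even).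
have -> : d = Ordinal (ltn0Sn 0) by apply: val_inj; rewrite (ord1 d).
by rewrite baker_class0 // mul0rn.
Qed.

End OneDimensional.

(** * Parity computations for the quadratic correction *)

Lemma odd_bin2 m : odd 'C(m, 2) = (2 <= m %% 4).
Proof.
elim/ltn_ind: m => [[|[|[|[|m]]]]] // IH.
have -> : 'C(m.+4, 2) = 'C(m, 2) + (m * 2 + 3) * 2.
  by rewrite !binS !bin0 !bin1; lia.
by rewrite oddD oddM andbF addbF IH //; lia.
Qed.

Lemma modn_half_parity A K u v : odd u = odd v ->
  A + K * u = A + K * v %[mod K * 2].
Proof.
move=> uv; have H w : A + K * w = A + K * odd w %[mod K * 2].
  by rewrite -{1}(odd_double_half w) mulnDr addnA -mul2n mulnA addnC (mulnC (K * 2)) modnMDl.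
by rewrite H uv -H.
Qed.

(* The weight compensating for the sign discrepancy between the two orders of
   subdivision of a brick when n = 2 and k = 3 mod 4. *)
Definition twist (l1 l2 : nat) := 'C(l1, 2) + 'C(l2, 2) + 'C(l2.+1 - l1, 2).

(** The first binomial gains l1 and the third loses l2 - l1; with truncated subtraction l1 + (l2 -
    l1) and l2 + (l1 - l2) are both the maximum. *)
Lemma odd_twistS1 l1 l2 : odd (twist l1.+1 l2) = odd (twist l1 l2 + l2 + (l1 - l2)).
Proof.
rewrite /twist binS bin1 subSS; case: (leqP l1 l2) => l12; last first.
  have [-> ->] : l2 - l1 = 0 /\ l2.+1 - l1 = 0 by lia.
  by rewrite !bin0n /=; lia.
by rewrite subSn // binS bin1; lia.
Qed.

Lemma odd_twistS2 l1 l2 : odd (twist l1 l2.+1) = odd (twist l1 l2 + l2 + (l2.+1 - l1)).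
Proof.
rewrite /twist binS bin1; case: (leqP l1 l2.+1) => l12; last first.
  have [-> ->] : l2.+2 - l1 = 0 /\ l2.+1 - l1 = 0 by lia.
  by rewrite !bin0n /=; lia.
by rewrite (subSn l12) binS bin1; lia.
Qed.

Lemma count_seq1 (T : Type) (a : pred T) x : count a [:: x] = a x.
Proof. by rewrite /= addn0. Qed.

(** * Dimension two with k = 3 modulo 4 *)

Section TwoDimensional.
Local Open Scope ring_scope.
Variables k r : nat.
Hypotheses (k2 : (2 <= k)%N) (r0 : (0 < r)%N).

Let n0 : (0 < 2)%N := ltn0Sn 1.
Let d0 : 'I_2 := Ordinal n0.
Let d1 : 'I_2 := Ordinal (ltnSn 1).
Local Notation brick := (brick 2 k r).
Local Notation Vab := (abelianization (thompson 2 k r)).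
Local Notation sw := (transp_class 2 k r).
Local Notation baker := (baker_class k r n0).

Lemma ord2E (d : 'I_2) : d = d0 \/ d = d1.
Proof. by case: d => [[|[|d]]] dlt //; [left|right]; apply: val_inj. Qed.

Lemma count_free (b : brick) m :
  count (fun p => digits n0 b p == None) (iota 0 (m * 2).+1) =
  ((m - size (b.2 d0)) + (m - size (b.2 d1)))%N.
Proof.
elim: m => [//|m IH].
have -> : iota 0 (m.+1 * 2).+1 = iota 0 (m * 2).+1 ++ [:: pos d0 m; pos d1 m].
  by rewrite -[in LHS](addn2 (m * 2).+1) iotaD /pos /= !add0n addn0 addn1.
rewrite count_cat IH -cat1s count_cat !count_seq1; cbv beta.
rewrite !digits_pos !digit_eq_none; lia.
Qed.

Lemma free_before_d0 (b : brick) : free_before n0 b d0 = (size (b.2 d0) - size (b.2 d1))%N.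
Proof.
rewrite /free_before; set l := size (b.2 d0).
have -> : pos d0 l = (l * 2).+1 by rewrite /pos /= addn0.
by rewrite count_free; lia.
Qed.

(** At each level direction 0 precedes direction 1, so one more position of direction 0 is examined;
    hence the successor. *)
Lemma free_before_d1 (b : brick) :
  free_before n0 b d1 = ((size (b.2 d1)).+1 - size (b.2 d0))%N.
Proof.
rewrite /free_before; set l := size (b.2 d1).
have -> : iota 0 (pos d1 l) = iota 0 (l * 2).+1 ++ [:: pos d0 l].
  have -> : pos d1 l = ((l * 2).+1 + 1)%N by rewrite /pos /=; lia.
  by rewrite iotaD add0n /pos /= addn0.
rewrite count_cat count_free count_seq1; cbv beta.
rewrite digits_pos digit_eq_none; lia.
Qed.

Section Twisted.
Hypothesis k3 : k = 3 %[mod 4].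

(** [g] generates the cyclic group of order 2 k - 2, and [s] = (k - 1) g is its element of order
    2. *)
Let g := cyc (2 * k - 2).
Let s := g *+ k.-1.

Lemma twisted_mod A u v : odd u = odd v ->
  g *+ (A + k.-1 * u) = g *+ (A + k.-1 * v).
Proof.
move=> uv; apply: cyc_mod; first by lia.
have -> : (2 * k - 2 = k.-1 * 2)%N by lia.
exact: modn_half_parity.
Qed.

Let twisted_weight (b : brick) : cyclicZ (2 * k - 2) :=
  g *+ (size (b.2 d1) + k.-1 * twist (size (b.2 d0)) (size (b.2 d1))).

Let gam (d : 'I_2) : cyclicZ (2 * k - 2) := g *+ (if d == d0 then k.-1 else 1).

Lemma odd_k : odd k. Proof. by move: k3; lia. Qed.

Lemma odd_C : odd 'C(k, 2). Proof. by rewrite odd_bin2 k3. Qed.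

(** The k pieces of weight A + (k - 1) u sum to A + (k - 1) (A + k u). Modulo 2 (k - 1) only the
    parity of the coefficient of k - 1 matters, and the increment of [twist] absorbs the extra A and
    the free positions. *)
Lemma twisted_weight_ext b d :
  \sum_(x <- spl d b) twisted_weight x + s *+ ('C(k, 2) * (free_before n0 b d).+1) =
  twisted_weight b + gam d.
Proof.
have kE (A K u : nat) : ((A + k.-1 * u) * k = A + k.-1 * (A + k * u))%N.
  by rewrite mulnDl -{1}(ltn_predK k2) mulnS; nia.
rewrite big_map /s -mulrnA.
case: (ord2E d) => ->.
  rewrite (eq_bigr (fun=> g *+ (size (b.2 d1) +
      k.-1 * twist (size (b.2 d0)).+1 (size (b.2 d1))))) => [|i _]; last first.
    by rewrite /twisted_weight !size_ext /= addn0 addn1.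
  rewrite big_const_seq count_predT size_enum_ord iter_addr_0 -mulrnA -!mulrnDr.
  rewrite free_before_d0 kE // -addnA -mulnDr.
  have -> : (size (b.2 d1) + k.-1 * twist (size (b.2 d0)) (size (b.2 d1)) + k.-1 =
    size (b.2 d1) + k.-1 * (twist (size (b.2 d0)) (size (b.2 d1))).+1)%N.
    by rewrite mulnS; lia.
  apply: twisted_mod; rewrite !oddD !oddM odd_twistS1 odd_k odd_C /= !oddD.
  by do 5!case: (odd _).
rewrite (eq_bigr (fun=> g *+ ((size (b.2 d1)).+1 +
    k.-1 * twist (size (b.2 d0)) (size (b.2 d1)).+1))) => [|i _]; last first.
  by rewrite /twisted_weight !size_ext /= addn0 addn1.
rewrite big_const_seq count_predT size_enum_ord iter_addr_0 -mulrnA -!mulrnDr.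
rewrite free_before_d1 kE // -addnA -mulnDr.
have -> : (size (b.2 d1) + k.-1 * twist (size (b.2 d0)) (size (b.2 d1)) + 1 =
  (size (b.2 d1)).+1 + k.-1 * twist (size (b.2 d0)) (size (b.2 d1)))%N by lia.
apply: twisted_mod; rewrite !oddD !oddM odd_twistS2 odd_k odd_C /= !oddD.
by do 5!case: (odd _).
Qed.

(** Here s = (k - 1) e_1, so e_1 generates the abelianization and its order divides 2 (k - 1). The
    character sends e_1 to k g, and k is its own inverse modulo 2 (k - 1). *)
Lemma ab_iso_twisted : zmod_isomorphic Vab (cyclicZ (2 * k - 2)).
Proof.
have M0 : (0 < 2 * k - 2)%N by lia.
have s2 : s *+ 2 = 0.
  by rewrite /s -mulrnA; apply: cyc_mulrn0 => //; apply/dvdnP; exists 1%N; lia.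
have [|f fD fE] := ab_character_normal (n0 := n0) k2 r0 s2 _ twisted_weight_ext.
  by rewrite odd_k.
have swE : sw = baker d1 *+ k.-1.
  by rewrite (baker_order (n0 := n0)) // sw_odd // odd_C.
have normal (x : Vab) : exists N, x = baker d1 *+ N.
  have [N [m ->]] := ab_normal_form n0 k2 r0 x.
  rewrite (bigD1 d0) //= (bigD1 d1) //= big1 => [|d /andP[dd0 dd1]]; last first.
    by case: (ord2E d) dd0 dd1 => ->; rewrite eqxx.
  rewrite baker_class0 // mul0rn add0r addr0 swE -mulrnA -mulrnDr.
  by eexists.
(* For odd k, k^2 - 1 is (k + 1) / 2 times 2 k - 2. *)
have kk m : (k * (k * m))%N = m %[mod 2 * k - 2].
  have -> : (k * (k * m) = (k.+1./2 * m) * (2 * k - 2) + m)%N.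
    have : (k.+1./2 * 2 = k.+1)%N by move: odd_k; lia.
    by move: k2; case: (k) => // k'; nia.
  by rewrite modnMDl.
have fN N : f (baker d1 *+ N) = g *+ (k * N).
  have := fE (fun d => if d == d1 then N else 0%N) 0%N.
  rewrite !mulr0n !addr0 (bigD1 d1) //= big1 ?addr0 => [->|d /negPf -> //].
  rewrite (bigD1 d1) //= big1 ?addr0 => [|d /negPf -> //].
  have sN : - s = s by apply/eqP; rewrite eq_sym -addr_eq0 -mulr2n s2.
  have -> : gam d1 - gam (Ordinal n0) = g *+ k.
    by rewrite /gam /= -/s sN /s -mulrnDr add1n (ltn_predK k2).
  by rewrite -mulrnA.
have gkk m : g *+ (k * (k * m)) = g *+ m by apply: cyc_mod.
apply: (zmod_isomorphicP fD) => [x|y]; last first.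
  have [m <-] := cyc_surj y; exists (baker d1 *+ (k * m)).
  by rewrite fN gkk.
have [N ->] := normal x; rewrite fN => kN.
have := gkk N; rewrite (mulnC k (k * N)) mulrnA kN mul0rn => /esym/eqP.
rewrite cyc_mulrn_eq0 // => /dvdnP[j ->].
have -> : (j * (2 * k - 2) = k.-1 * 2 * j)%N by lia.
by rewrite mulrnA baker_order2 // mul0rn.
Qed.

End Twisted.
End TwoDimensional.

(** * Powers with exponent 0 and 1 *)

Section SmallIsomorphisms.
Local Open Scope ring_scope.

Lemma zmod_isomorphic_ffun0 (A : zmodType) :
  zmod_isomorphic {ffun 'I_0 -> A} (cyclicZ 1).
Proof.
apply: (@zmod_isomorphicP _ _ (fun=> 0)) => [x y|x _|y]; first by rewrite addr0.
  by apply/ffunP; case.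
by exists 0; rewrite [y]ord1.
Qed.

Lemma zmod_isomorphic_ffun1 (A : zmodType) : zmod_isomorphic {ffun 'I_1 -> A} A.
Proof.
apply: (@zmod_isomorphicP _ _ (fun x : {ffun 'I_1 -> A} => x ord0)) => [x y|x x0|y].
- by rewrite ffunE.
- by apply/ffunP => i; rewrite ord1 x0 ffunE.
- by exists [ffun=> y]; rewrite ffunE.
Qed.

Lemma zmod_isomorphic_prodl (A A' B : zmodType) :
  zmod_isomorphic A A' -> zmod_isomorphic (A * B)%type (A' * B)%type.
Proof.
move=> [f [g fK gK]].
apply: (@zmod_isomorphicP _ _ (fun x : A * B => (f x.1, x.2))) => [x y|[x y] [/= fx ->]|[x y]].
- by rewrite raddfD.
- by rewrite -(fK x) fx -(raddf0 f) fK.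
- by exists (g x, y); rewrite /= gK.
Qed.

End SmallIsomorphisms.

(** For two distinct directions other than 0, both (k - 1) e_d equal s by [baker_order], while their
    difference is s as well; so s = 0. *)
Lemma transp_class_eq0 n k r : 3 <= n -> 2 <= k -> 0 < r -> odd 'C(k, 2) ->
  transp_class n k r = 0%R.
Proof.
move=> n3 k2 r0 Codd; have n0 : 0 < n by apply: leq_trans n3.
have n2 : 1 < n by apply: leq_trans n3.
pose d1 : 'I_n := Ordinal n2; pose d2 : 'I_n := Ordinal n3.
have := baker_class_relation n0 k2 r0 (isT : d1 != d2).
rewrite !baker_order // sw_odd // Codd mulr1n => /eqP.
by rewrite -[X in X == _]addr0 (inj_eq (addrI _)) eq_sym => /eqP.
Qed.

(** * Assembly of the cases by n and by k modulo 4 *)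

Theorem theorem5p20 (n k r : nat) :
  1 <= n -> 2 <= k -> 1 <= r ->
  let Vab : zmodType := abelianization (thompson n k r) in
  (n = 1 ->
     (~~ odd k -> zmod_isomorphic Vab (cyclicZ 1)) /\
     (odd k -> zmod_isomorphic Vab (cyclicZ 2)))
  /\
  (n = 2 ->
     (~~ odd k -> zmod_isomorphic Vab (cyclicZ (k - 1))) /\
     (k = 1 %[mod 4] ->
        zmod_isomorphic Vab (cyclicZ (k - 1) * cyclicZ 2)%type) /\
     (k = 3 %[mod 4] -> zmod_isomorphic Vab (cyclicZ (2 * k - 2))))
  /\
  (3 <= n ->
     (~~ odd k \/ k = 3 %[mod 4] ->
        zmod_isomorphic Vab {ffun 'I_(n - 1) -> cyclicZ (k - 1)}) /\
     (k = 1 %[mod 4] ->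
        zmod_isomorphic Vab
          ({ffun 'I_(n - 1) -> cyclicZ (k - 1)} * cyclicZ 2)%type)).
Proof.
move=> n0 k2 r0 Vab; rewrite {}/Vab.
(* The next two isomorphisms are uniform in n; for n = 1 and n = 2 the power is simplified
   afterwards. *)
have iso_even : ~~ odd k -> zmod_isomorphic (abelianization (thompson n k r))
    {ffun 'I_(n - 1) -> cyclicZ (k - 1)}.
  by move=> k_even; apply: (ab_iso_ffun n0 k2 r0); apply: transp_even.
have iso_mod1 : k = 1 %[mod 4] -> zmod_isomorphic (abelianization (thompson n k r))
    ({ffun 'I_(n - 1) -> cyclicZ (k - 1)} * cyclicZ 2)%type.
  by move=> k1; apply: (ab_iso_ffun_prod n0 k2 r0); rewrite ?odd_bin2 ?k1 //; lia.
split=> [nE|]; last split=> [nE|n3].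
- subst n; split; last exact: ab_iso_1_odd.
  by move=> /iso_even /zmod_isomorphic_trans; apply; apply: zmod_isomorphic_ffun0.
- subst n; split; last split.
  + by move=> /iso_even /zmod_isomorphic_trans; apply; apply: zmod_isomorphic_ffun1.
  + move=> /iso_mod1 /zmod_isomorphic_trans; apply; apply: zmod_isomorphic_prodl.
    exact: zmod_isomorphic_ffun1.
  + by move=> k3; apply: ab_iso_twisted.
- split=> // -[//|k3]; apply: (ab_iso_ffun n0 k2 r0).
  by apply: transp_class_eq0; rewrite ?odd_bin2 ?k3.
Qed.
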